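(* Let $A\in\mathbb{R}^{m\times n}$ with $\mathrm{nnz}(A)\ge m+n$, let $\epsilon>0$ and let $\alpha\ge\epsilon/\log(nm)$. The randomized algorithm described in the context, run on $(A,\epsilon)$ with parameter $\alpha$, outputs a point $z=(z^{\mathsf x},z^{\mathsf y})\in\Delta^n\times\Delta^m$ such that $$\mathbb{E}\Big[\max_{y\in\Delta^m}y^\top A z^{\mathsf x}-\min_{x\in\Delta^n}(z^{\mathsf y})^\top A x\Big]=\mathbb{E}\Big[\max_i\,[Az^{\mathsf x}]_i-\min_j\,[A^\top z^{\mathsf y}]_j\Big]\le\epsilon,$$ and runs in time $$O\left(\left(\mathrm{nnz}(A)+\frac{(m+n)\|A\|_{\max}^2}{\alpha^2}\right)\frac{\alpha\log(mn)}{\epsilon}\right).$$ With the optimal setting of $\alpha$, the running time is $$O\left(\mathrm{nnz}(A)+\frac{\sqrt{\mathrm{nnz}(A)(m+n)}\,\|A\|_{\max}\log(mn)}{\epsilon}\right).$$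
   Context: Notation: $\Delta^d=\{v\in\mathbb{R}^d: v\ge 0,\ \|v\|_1=1\}$; $\mathrm{nnz}(A)$ is the number of nonzero entries of $A$; $\|A\|_{\max}=\max_{i,j}|A_{ij}|$; $A_{i:}$ and $A_{:j}$ are the $i$th row and $j$th column of $A$ (as vectors); $[v]_i$ is the $i$th coordinate; for $z\in\mathbb{R}^n\times\mathbb{R}^m$, $z^{\mathsf x},z^{\mathsf y}$ are its first $n$ and last $m$ coordinates. Running time counts elementary operations (arithmetic, $\exp$, $\log$, drawing a random number) at unit cost each; $\log$ and $\exp$ of vectors are coordinatewise. Algorithm (input $A$, $\epsilon$; parameter $\alpha$). Put $L=\|A\|_{\max}$, $K=\lceil\alpha\log(nm)/\epsilon\rceil$, $\eta=\alpha/(10L^2)$, $T=\lceil 4/(\eta\alpha)\rceil$, $z_0=(\tfrac1n\mathbf 1_n,\tfrac1m\mathbf 1_m)$, and $\Pi(v)=e^v/\|e^v\|_1$. For $k=1,\dots,K$: (1) Set $(x_0,y_0)=(z_{k-1}^{\mathsf x},z_{k-1}^{\mathsf y})$ and $g_0=(g_0^{\mathsf x},g_0^{\mathsf y})=(A^\top y_0,-Ax_0)$. (2) For $t=1,\dots,T$: sample independently (with fresh randomness) $i\sim p$ with $p_i=|[y_{t-1}]_i-[y_0]_i|/\|y_{t-1}-y_0\|_1$ and $j\sim q$ with $q_j=|[x_{t-1}]_j-[x_0]_j|/\|x_{t-1}-x_0\|_1$; set $\tilde g_{t-1}=g_0+\big(A_{i:}\frac{[y_{t-1}]_i-[y_0]_i}{p_i},\,-A_{:j}\frac{[x_{t-1}]_j-[x_0]_j}{q_j}\big)$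 (an increment is taken to be $0$ if the corresponding difference $y_{t-1}-y_0$ or $x_{t-1}-x_0$ is zero); set $x_t=\Pi\big(\frac{1}{1+\eta\alpha/2}(\log x_{t-1}+\frac{\eta\alpha}{2}\log x_0-\eta\tilde g_{t-1}^{\mathsf x})\big)$ and $y_t=\Pi\big(\frac{1}{1+\eta\alpha/2}(\log y_{t-1}+\frac{\eta\alpha}{2}\log y_0-\eta\tilde g_{t-1}^{\mathsf y})\big)$. (3) Set $z_{k-1/2}=\frac1T\sum_{t=1}^T(x_t,y_t)$. (4) Set $z_k^{\mathsf x}=\Pi(\log z_{k-1}^{\mathsf x}-\frac1\alpha A^\top z_{k-1/2}^{\mathsf y})$ and $z_k^{\mathsf y}=\Pi(\log z_{k-1}^{\mathsf y}+\frac1\alpha A z_{k-1/2}^{\mathsf x})$. Output: $\frac1K\sum_{k=1}^K z_{k-1/2}$. *)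

(* Defs.v *)
From HB Require Import structures.
From mathcomp Require Import all_boot all_order all_algebra.
From mathcomp Require Import all_classical all_reals all_analysis.

Set Implicit Arguments.
Unset Strict Implicit.
Unset Printing Implicit Defensive.

Import Order.TTheory GRing.Theory Num.Theory.
Import numFieldNormedType.Exports.

Local Open Scope classical_set_scope.
Local Open Scope ring_scope.

(** * Randomized programs over unit-cost elementary operations

    [prog V A] is the type of programs that manipulate numbers of type [V] and
    return an [A].  Each constructor except [Ret] is one elementary operation.
    Programs are written below for an arbitrary type [V] and only afterwards
    instantiated with the reals, so that a program has no means of computing
    with numbers, or of branching on them, other than the counted
    operations. *)

Inductive unary_op := Opposite | Absolute | Exponential | Logarithm.
Inductive binary_op := Plus | Minus | Times | Divide.

Inductive prog (V A : Type) : Type :=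
| Ret of A
| Const of nat & (V -> prog V A)
| Unary of unary_op & V & (V -> prog V A)
| Binary of binary_op & V & V & (V -> prog V A)
| Less of V & V & (bool -> prog V A)
| Ceil of V & (nat -> prog V A)
| Draw of (V -> prog V A). (* a fresh uniform random number in [0, 1] *)

Arguments Ret {V A}.

Fixpoint bind V A B (p : prog V A) (f : A -> prog V B) : prog V B :=
  match p with
  | Ret a => f a
  | Const q k => Const q (fun v => bind (k v) f)
  | Unary o v k => Unary o v (fun w => bind (k w) f)
  | Binary o v w k => Binary o v w (fun r => bind (k r) f)
  | Less v w k => Less v w (fun b => bind (k b) f)
  | Ceil v k => Ceil v (fun q => bind (k q) f)
  | Draw k => Draw (fun u => bind (k u) f)
  end.

Notation "'let*' x ':=' p 'in' q" := (bind p (fun x => q))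
  (at level 200, x pattern, p at level 200, q at level 200,
   format "'[v' 'let*'  x  ':='  '[' p ']'  'in' '/' q ']'").

(** ** Semantics over the reals *)

Section semantics.
Context {R : realType}.

Definition unary_sem (o : unary_op) : R -> R :=
  match o with
  | Opposite => fun v => - v
  | Absolute => fun v => `|v|
  | Exponential => fun v => expR v
  | Logarithm => fun v => ln v
  end.

Definition binary_sem (o : binary_op) : R -> R -> R :=
  match o with
  | Plus => fun v w => v + w
  | Minus => fun v w => v - w
  | Times => fun v w => v * w
  | Divide => fun v w => v / w
  end.

(* [Ceil] is only applied to positive numbers. *)
Definition ceil_sem (v : R) : nat := `|Num.ceil v|%N.

(* Result and number of elementary operations of the execution of [p] in which
   the successive random numbers drawn are [u 0], [u 1], ... *)
Fixpoint run A (u : nat -> R) (p : prog R A) : A * nat :=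
  let tick (r : A * nat) := (r.1, r.2.+1) in
  match p with
  | Ret a => (a, 0%N)
  | Const q k => tick (run u (k q%:R))
  | Unary o v k => tick (run u (k (unary_sem o v)))
  | Binary o v w k => tick (run u (k (binary_sem o v w)))
  | Less v w k => tick (run u (k (v < w)))
  | Ceil v k => tick (run u (k (ceil_sem v)))
  | Draw k => tick (run (fun i => u i.+1) (k (u 0%N)))
  end.

Definition result A (u : nat -> R) (p : prog R A) : A := (run u p).1.
Definition time A (u : nat -> R) (p : prog R A) : nat := (run u p).2.

(* The sequences of values that uniform draws can take. *)
Definition tapes : set (nat -> R) := [set u | forall i, 0 <= u i <= 1].

(* Expectation of [f] at the result of [p], the draws being independent and
   uniform on [0, 1]. *)
Fixpoint expectation_of A (p : prog R A) (f : A -> R) : R :=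
  match p with
  | Ret a => f a
  | Const q k => expectation_of (k q%:R) f
  | Unary o v k => expectation_of (k (unary_sem o v)) f
  | Binary o v w k => expectation_of (k (binary_sem o v w)) f
  | Less v w k => expectation_of (k (v < w)) f
  | Ceil v k => expectation_of (k (ceil_sem v)) f
  | Draw k =>
      \int[lebesgue_measure]_(u in (`[0, 1]%classic : set R))
         expectation_of (k u) f
  end.

End semantics.

(** * The algorithm *)

(* A matrix together with the positions of the nonzero entries of each row and
   of each column. *)
Record sparse_matrix (V : Type) (m n : nat) := SparseMatrix {
  entry : 'I_m -> 'I_n -> V;
  row_nz : 'I_m -> seq 'I_n;
  col_nz : 'I_n -> seq 'I_m }.

Definition sparse_of (R : realType) m n (A : 'M[R]_(m, n)) :
    sparse_matrix R m n :=
  SparseMatrix (fun i j => A i j)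
    (fun i => [seq j <- enum 'I_n | A i j != 0])
    (fun j => [seq i <- enum 'I_m | A i j != 0]).

Section algorithm.
Context {V : Type}.
Implicit Types (m n : nat) (v w : V).

Definition const (q : nat) : prog V V := Const q Ret.
Definition neg v : prog V V := Unary Opposite v Ret.
Definition abs v : prog V V := Unary Absolute v Ret.
Definition exp v : prog V V := Unary Exponential v Ret.
Definition log v : prog V V := Unary Logarithm v Ret.
Definition binary (o : binary_op) v w : prog V V := Binary o v w Ret.
Definition add := binary Plus.
Definition mul := binary Times.
Definition div := binary Divide.
Definition less v w : prog V bool := Less v w Ret.
Definition ceil v : prog V nat := Ceil v Ret.
Definition draw : prog V V := Draw Ret.

Fixpoint fold S I (f : S -> I -> prog V S) (s : S) (r : seq I) : prog V S :=
  if r is i :: r' then let* s' := f s i in fold f s' r' else Ret s.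

Definition repeat S (k : nat) (f : S -> prog V S) (s : S) : prog V S :=
  fold (fun s' _ => f s') s (iota 0 k).

Fixpoint tabulate_tuple n : ('I_n -> prog V V) -> prog V (n.-tuple V) :=
  match n with
  | 0%N => fun=> Ret [tuple]
  | n'.+1 => fun F =>
      let* v := F ord0 in
      let* t := tabulate_tuple (fun i => F (lift ord0 i)) in
      Ret [tuple of v :: t]
  end.

Definition tabulate n (F : 'I_n -> prog V V) : prog V 'cV[V]_n :=
  let* t := tabulate_tuple F in Ret (\col_i tnth t i).

Definition sum_over I (r : seq I) (F : I -> prog V V) : prog V V :=
  let* z := const 0 in
  fold (fun s i => let* v := F i in add s v) z r.

Definition norm1 n (x : 'cV[V]_n) : prog V V :=
  sum_over (enum 'I_n) (fun i => abs (x i 0)).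

Definition vec2 (o : binary_op) n (x y : 'cV[V]_n) : prog V 'cV[V]_n :=
  tabulate (fun i => binary o (x i 0) (y i 0)).

Definition scale n v (x : 'cV[V]_n) : prog V 'cV[V]_n :=
  tabulate (fun i => mul v (x i 0)).

Definition logv n (x : 'cV[V]_n) : prog V 'cV[V]_n :=
  tabulate (fun i => log (x i 0)).

Definition fill n (c : prog V V) : prog V 'cV[V]_n :=
  tabulate (fun=> c).

(* Pi(v) = e^v / |e^v|_1 *)
Definition softmax n (x : 'cV[V]_n) : prog V 'cV[V]_n :=
  let* e := tabulate (fun i => exp (x i 0)) in
  let* s := norm1 e in
  tabulate (fun i => div (e i 0) s).

(* A x *)
Definition mulA m n (A : sparse_matrix V m n) (x : 'cV[V]_n) :
    prog V 'cV[V]_m :=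
  tabulate (fun i => sum_over (row_nz A i) (fun j => mul (entry A i j) (x j 0))).

(* A^T y *)
Definition mulAT m n (A : sparse_matrix V m n) (y : 'cV[V]_m) :
    prog V 'cV[V]_n :=
  tabulate (fun j => sum_over (col_nz A j) (fun i => mul (entry A i j) (y i 0))).

Definition max_norm m n (A : sparse_matrix V m n) : prog V V :=
  let* z := const 0 in
  fold (fun L i => fold (fun L j =>
      let* a := abs (entry A i j) in
      let* b := less L a in
      Ret (if b then a else L)) L (row_nz A i)) z (enum 'I_m).

(* Inversion sampling of an index with distribution [p]: returns the first [i]
   in [r] such that [u < c + (sum of p over r up to and including i)].  When
   [p] is a probability vector, [None] is only possible for u = 1. *)
Fixpoint locate n (p : 'cV[V]_n) (u c : V) (r : seq 'I_n) :
    prog V (option 'I_n) :=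
  if r is i :: r' then
    let* c' := add c (p i 0) in
    let* b := less u c' in
    if b then Ret (Some i) else locate p u c' r'
  else Ret None.

Definition sample n (p : 'cV[V]_n) : prog V (option 'I_n) :=
  let* u := draw in
  let* z := const 0 in
  locate p u z (enum 'I_n).

(* [g0 + B i * (d_i / p_i)] (or [g0 - B i * (d_i / p_i)] when [o] is [Minus]),
   with [d = w - w0], [p_i = |d_i| / |d|_1] and [i] sampled from [p]; the
   increment is 0 if [d = 0]. *)
Definition estimate (o : binary_op) m n (B : 'I_m -> 'I_n -> V)
    (g0 : 'cV[V]_n) (w w0 : 'cV[V]_m) : prog V 'cV[V]_n :=
  let* d := vec2 Minus w w0 in
  let* D := norm1 d in
  let* z := const 0 in
  let* nonzero := less z D in
  if nonzero then
    let* p := tabulate (fun i => let* a := abs (d i 0) in div a D) in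
    let* r := sample p in
    if r is Some i then
      let* c := div (d i 0) (p i 0) in
      tabulate (fun j => let* a := mul (B i j) c in binary o (g0 j 0) a)
    else Ret g0
  else Ret g0.

(* Pi ((log x + h * log x0 - eta * g) / (1 + h)), where h = eta * alpha / 2 *)
Definition inner_update n (eta h : V) (x x0 g : 'cV[V]_n) : prog V 'cV[V]_n :=
  let* one := const 1 in
  let* h1 := add one h in
  let* c := div one h1 in
  let* lx := logv x in
  let* lx0 := logv x0 in
  let* hlx0 := scale h lx0 in
  let* s := vec2 Plus lx hlx0 in
  let* eg := scale eta g in
  let* d := vec2 Minus s eg in
  let* a := scale c d in
  softmax a.

Definition strategies n m : Type := ('cV[V]_n * 'cV[V]_m)%type.

Definition add_strategies n m (z z' : strategies n m) : prog V (strategies n m) :=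
  let* x := vec2 Plus z.1 z'.1 in
  let* y := vec2 Plus z.2 z'.2 in
  Ret (x, y).

Definition zero_strategies n m : prog V (strategies n m) :=
  let* x := fill n (const 0) in
  let* y := fill m (const 0) in
  Ret (x, y).

(* z / k *)
Definition average n m (k : nat) (z : strategies n m) : prog V (strategies n m) :=
  let* one := const 1 in
  let* q := const k in
  let* c := div one q in
  let* x := scale c z.1 in
  let* y := scale c z.2 in
  Ret (x, y).

(* The map z_{t-1} |-> z_t. *)
Definition inner_step m n (A : sparse_matrix V m n) (eta h : V)
    (z0 g0 z : strategies n m) : prog V (strategies n m) :=
  let* gx := estimate Plus (entry A) g0.1 z.2 z0.2 in
  let* gy := estimate Minus (fun j i => entry A i j) g0.2 z.1 z0.1 in
  let* x := inner_update eta h z.1 z0.1 gx in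
  let* y := inner_update eta h z.2 z0.2 gy in
  Ret (x, y).

(* The map z_{k-1} |-> z_{k-1/2}. *)
Definition inner_loop m n (A : sparse_matrix V m n) (eta h : V) (T : nat)
    (z0 : strategies n m) : prog V (strategies n m) :=
  let* g0x := mulAT A z0.2 in
  let* Ax0 := mulA A z0.1 in
  let* g0y := tabulate (fun i => neg (Ax0 i 0)) in
  let* sum0 := zero_strategies n m in
  let* zS := repeat T (fun zS =>
      let* z := inner_step A eta h z0 (g0x, g0y) zS.1 in
      let* s := add_strategies zS.2 z in
      Ret (z, s)) (z0, sum0) in
  average T zS.2.

(* The map (z_{k-1}, z_{k-1/2}) |-> z_k. *)
Definition outer_update m n (A : sparse_matrix V m n) (alpha : V)
    (z zhalf : strategies n m) : prog V (strategies n m) :=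
  let* one := const 1 in
  let* c := div one alpha in
  let* gx := mulAT A zhalf.2 in
  let* cgx := scale c gx in
  let* lx := logv z.1 in
  let* ax := vec2 Minus lx cgx in
  let* x := softmax ax in
  let* gy := mulA A zhalf.1 in
  let* cgy := scale c gy in
  let* ly := logv z.2 in
  let* ay := vec2 Plus ly cgy in
  let* y := softmax ay in
  Ret (x, y).

Definition matrix_game m n (A : sparse_matrix V m n) (eps alpha : V) :
    prog V (strategies n m) :=
  let* L := max_norm A in
  let* vn := const n in
  let* vm := const m in
  let* nm := mul vn vm in
  let* lognm := log nm in
  let* a := mul alpha lognm in
  let* r := div a eps in
  let* K := ceil r in
  let* ten := const 10 in
  let* LL := mul L L in
  let* tenLL := mul ten LL in
  let* eta := div alpha tenLL in
  let* ea := mul eta alpha in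
  let* four := const 4 in
  let* q := div four ea in
  let* T := ceil q in
  let* two := const 2 in
  let* h := div ea two in
  let* one := const 1 in
  let* x0 := fill n (div one vn) in
  let* y0 := fill m (div one vm) in
  let* sum0 := zero_strategies n m in
  let* zS := repeat K (fun zS =>
      let* zhalf := inner_loop A eta h T zS.1 in
      let* z := outer_update A alpha zS.1 zhalf in
      let* s := add_strategies zS.2 zhalf in
      Ret (z, s)) ((x0, y0), sum0) in
  average K zS.2.

End algorithm.

(** * Matrix games *)

Section games.
Context {R : realType}.
Implicit Types (m n : nat).

Definition simplex n : set 'cV[R]_n :=
  [set v | (forall i, 0 <= v i 0) /\ \sum_i `|v i 0| = 1].

Definition nnz m n (A : 'M[R]_(m, n)) : nat := #|[set ij | A ij.1 ij.2 != 0]%SET|.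

(* max_{y in Delta^m} y^T A z^x - min_{x in Delta^n} (z^y)^T A x *)
Definition duality_gap m n (A : 'M[R]_(m, n)) (z : strategies n m) : R :=
  sup [set (y^T *m A *m z.1) 0 0 | y in @simplex m] -
  inf [set (z.2^T *m A *m x) 0 0 | x in @simplex n].

(* max_i [A z^x]_i - min_j [A^T z^y]_j *)
Definition coordinate_gap m n (A : 'M[R]_(m, n)) (z : strategies n m) : R :=
  sup (range (fun i => (A *m z.1) i 0)) -
  inf (range (fun j => (A^T *m z.2) j 0)).

Definition algorithm m n (A : 'M[R]_(m, n)) (eps alpha : R) : prog R (strategies n m) :=
  matrix_game (sparse_of A) eps alpha.

(* log (n m) *)
Definition log_size m n : R := ln (n * m)%N%:R.

(* (nnz(A) + (m + n) |A|_max^2 / alpha^2) * (alpha log(mn) / eps); [mx_norm] is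
   the largest absolute value of an entry. *)
Definition time_bound m n (A : 'M[R]_(m, n)) (eps alpha : R) : R :=
  ((nnz A)%:R + (m + n)%:R * mx_norm A ^+ 2 / alpha ^+ 2) *
  (alpha * log_size m n / eps).

(* nnz(A) + sqrt(nnz(A) (m + n)) |A|_max log(mn) / eps *)
Definition optimal_time_bound m n (A : 'M[R]_(m, n)) (eps : R) : R :=
  (nnz A)%:R +
  Num.sqrt ((nnz A)%:R * (m + n)%:R) * mx_norm A * log_size m n / eps.

(* alpha minimizes [time_bound] among the admissible parameters. *)
Definition optimal_parameter m n (A : 'M[R]_(m, n)) (eps alpha : R) : Prop :=
  eps / log_size m n <= alpha /\
  forall beta, eps / log_size m n <= beta ->
    time_bound A eps alpha <= time_bound A eps beta.

End games.

(* Main.v *)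
Require Import Defs.
From HB Require Import structures.
From mathcomp Require Import all_boot all_order all_algebra.
From mathcomp Require Import all_classical all_reals all_analysis.
From mathcomp Require Import zify ring lra.

Set Implicit Arguments.
Unset Strict Implicit.
Unset Printing Implicit Defensive.

Import Order.TTheory GRing.Theory Num.Theory.
Import numFieldNormedType.Exports.

Local Open Scope classical_set_scope.
Local Open Scope ring_scope.

Implicit Types R : realType.

(* A draw only selects an index by inversion, so expectations of programs are
   finite weighted sums and no measurability question arises.  Write [V u z]
   for the relative entropy of [u] with respect to [z] and
   [regret z u = - <g z, u>], which is linear in [z].

   Inner loop.  With [h = eta alpha / 2], optimality of an entropic step at
   [z_t] gives an identity whose error terms are [<a - a~, z_t - u>] and
   [<a~, z_t - z_(t+1)>], where [a = g z_t - g z_0] and [a~] is its estimate,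
   both bounded by [L |z_t - z_0|_1].  The second is absorbed by
   [V z_(t+1) z_t] with Pinsker's inequality.  For the first, since [u] may
   depend on all draws, a ghost sequence [s_t] runs mirror descent on
   [a - a~]: this costs an additional [V u z_0] and leaves the martingale
   increments [<a - a~, z_t - s_t>].  All quadratic terms add up to at most
   [5 eta^2 L^2 V z_t z_0 = h V z_t z_0], which the regularization cancels, and
   [T >= 4 / (eta alpha)] yields
   [E max_u (regret z_half u - alpha V u z_0) <= 0].  The ghost sequence is not
   part of the program: the expectation of the remaining rounds is bounded by
   backward induction, for every value of the ghost iterate and of the
   martingale.

   Outer loop.  An extragradient step from [z] to [z'] satisfies
   [regret z_half u <= alpha (V u z - V u z') + rho] as soon as
   [regret z_half u <= alpha V u z + rho] holds at [u = z']; summing over the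
   rounds bounds the regret of the output by [alpha log(nm) / K <= eps].

   The optimal [alpha] is [max (eps / log(nm)) (L sqrt ((m + n) / nnz A))]. *)


(** * Executions and expectations of programs *)

(* In particular [within p c (eq v)] says that [p] computes [v] in at most [c]
   operations. *)
Fixpoint within R A (p : prog R A) (c : nat) (Q : A -> Prop) : Prop :=
  match p, c with
  | Ret a, _ => Q a
  | _, 0%N => False
  | Const q k, c'.+1 => within (k q%:R) c' Q
  | Unary o v k, c'.+1 => within (k (unary_sem o v)) c' Q
  | Binary o v w k, c'.+1 => within (k (binary_sem o v w)) c' Q
  | Less v w k, c'.+1 => within (k (v < w)) c' Q
  | Ceil v k, c'.+1 => within (k (ceil_sem v)) c' Q
  | Draw k, c'.+1 => forall u, 0 <= u <= 1 -> within (k u) c' Q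
  end.

Lemma within_mono R A (p : prog R A) c c' (Q Q' : A -> Prop) :
  within p c Q -> (c <= c')%N -> (forall a, Q a -> Q' a) -> within p c' Q'.
Proof.
move=> + + QQ'; elim: p c c' => [a|q k IH|o v k IH|o v w k IH|v w k IH|v k IH|k IH]
  [|c] [|c'] //=; try by [move=> /QQ' | move=> p_c cc'; exact: IH p_c cc'].
by move=> p_c cc' u u01; exact: IH (p_c u u01) cc'.
Qed.

Lemma within_leq R A (p : prog R A) c c' (Q : A -> Prop) :
  within p c Q -> (c <= c')%N -> within p c' Q.
Proof. by move=> p_c cc'; exact: within_mono p_c cc' _. Qed.

Lemma within_bind R A B (p : prog R A) (f : A -> prog R B) c d Q Q' :
  within p c Q -> (forall a, Q a -> within (f a) d Q') ->
  within (bind p f) (c + d) Q'.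
Proof.
move=> + fQ; elim: p c => [a|q k IH|o v k IH|o v w k IH|v w k IH|v k IH|k IH]
  [|c] //=; try by [move=> /fQ | exact: IH].
- by move=> /fQ f_d; apply: within_leq f_d _; rewrite leq_addl.
- by move=> p_c u u01; exact: IH (p_c u u01).
Qed.

Lemma within_let R A B (p : prog R A) (f : A -> prog R B) c d v Q :
  within p c (eq v) -> within (f v) d Q -> within (bind p f) (c + d) Q.
Proof. by move=> p_c f_d; apply: within_bind p_c _ => _ <-. Qed.

Lemma within_run R A (p : prog R A) c (Q : A -> Prop) u :
  within p c Q -> tapes u -> Q (result u p) /\ (time u p <= c)%N.
Proof.
rewrite /result /time.
elim: p c u => [a|q k IH|o v k IH|o v w k IH|v w k IH|v k IH|k IH] [|c] u //=;
  try by [move=> p_c u_tape; exact: IH].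
move=> p_c u_tape; apply: IH; first by apply: p_c; exact: u_tape.
by move=> i; exact: u_tape.
Qed.

(** The expectation is an iterated integral by definition, so composing programs only rewrites under
    the integral sign. *)
Lemma expectation_bind R A B (p : prog R A) (f : A -> prog R B) (F : B -> R) :
  expectation_of (bind p f) F =
  expectation_of p (fun a => expectation_of (f a) F).
Proof.
elim: p => [a|q k IH|o v k IH|o v w k IH|v w k IH|v k IH|k IH] //=.
by apply: eq_Rintegral => u _; exact: IH.
Qed.

Lemma Rintegral01_cst R (c : R) :
  \int[lebesgue_measure]_(u in (`[0, 1]%classic : set R)) c = c.
Proof.
rewrite Rintegral_cst//= lebesgue_measure_itv/= lte_fin ltr01.
by rewrite -EFinB subr0 mulr1.
Qed.

(** Each draw integrates a constant over an interval of length 1. This evaluates deterministic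
    subprograms inside an expectation. *)
Lemma expectation_within R A (p : prog R A) c Q (F : A -> R) x :
  within p c Q -> (forall a, Q a -> F a = x) -> expectation_of p F = x.
Proof.
move=> + FQ; elim: p c => [a|q k IH|o v k IH|o v w k IH|v w k IH|v k IH|k IH]
  [|c] //=; try by [move=> /FQ | exact: IH].
move=> p_c; rewrite -[RHS]Rintegral01_cst; apply: eq_Rintegral => u.
by rewrite inE/= in_itv/= => u01; exact: IH (p_c _ u01).
Qed.

Lemma expectation_let R A B (p : prog R A) (f : A -> prog R B) c v F :
  within p c (eq v) -> expectation_of (bind p f) F = expectation_of (f v) F.
Proof. by move=> p_c; rewrite expectation_bind; apply: expectation_within p_c _ => _ <-. Qed.

(** * Sampling *)

Fixpoint first_above R n (p : 'cV[R]_n) (u c : R) (r : seq 'I_n) : option 'I_n :=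
  if r is i :: r' then
    if u < c + p i 0 then Some i else first_above p u (c + p i 0) r'
  else None.

Lemma within_locate R n (p : 'cV[R]_n) u c r :
  within (locate p u c r) (2 * size r) (eq (first_above p u c r)).
Proof.
elim: r c => [//|i r IH] c.
rewrite (mulnS 2 (size r)) add2n /=.
by case: ifP => // _; exact: IH.
Qed.

Lemma measurable_first_above R n (p : 'cV[R]_n) c r (F : option 'I_n -> R) :
  measurable_fun setT (fun u => F (first_above p u c r)).
Proof.
elim: r c => [|i r IH] c /=; first exact: measurable_cst.
rewrite [X in measurable_fun _ X](_ : _ = (fun u =>
  if u < c + p i 0 then F (Some i) else F (first_above p u (c + p i 0) r))).
  by apply: measurable_fun_ifT => //; exact: measurable_realfun.measurable_fun_ltr.
by apply/funext => u; case: ifP.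
Qed.

(** As a function of the draw this takes finitely many values, so the sum of their absolute values
    is a bound. *)
Lemma integrable_first_above R n (p : 'cV[R]_n) c r (F : option 'I_n -> R) (a b : R) :
  lebesgue_measure.-integrable `[a, b[ (EFin \o (fun u => F (first_above p u c r))).
Proof.
apply: measurable_bounded_integrable => //=.
- rewrite lebesgue_measure_itv/=; case: ifP => // _.
  by rewrite -EFinB ltry.
- exact: measurable_funTS (measurable_first_above _ _ _ _).
- exists (\sum_o `|F o|); split; first by rewrite num_real.
  move=> M FM u _ /=; apply: le_trans (ltW FM).
  by rewrite (bigD1 (first_above p u c r))//= lerDl sumr_ge0.
Qed.

(** Inversion sampling: the first interval [[c, c + p i 0[] selects [i] and has length [p i 0]; the
    induction hypothesis covers the rest. Half-open intervals match the strict test and are empty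
    when [p i 0] vanishes. *)
Lemma Rintegral_first_above R n (p : 'cV[R]_n) (F : option 'I_n -> R) r (c b : R) :
  (forall i, 0 <= p i 0) -> c + \sum_(i <- r) p i 0 = b ->
  \int[lebesgue_measure]_(u in `[c, b[) F (first_above p u c r) =
  \sum_(i <- r) p i 0 * F (Some i).
Proof.
move=> p_ge0; elim: r c => [|i r IH] c.
  by rewrite !big_nil addr0 => ->; rewrite set_itvco0 Rintegral_set0.
rewrite !big_cons addrA => cb.
have c_le : c <= c + p i 0 by rewrite lerDl.
have le_b : c + p i 0 <= b by rewrite -cb lerDl sumr_ge0.
have split_itv : `[c, b[%classic =
    `[c, (c + p i 0)[%classic `|` `[(c + p i 0), b[%classic.
  by rewrite -itv_bndbnd_setU ?bnd_simp.
have /= integrable_F := integrable_first_above p c (i :: r) F c b.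
rewrite split_itv Rintegral_setU//=; last 2 first.
- by rewrite -split_itv.
- apply/disj_setPS => u [/=]; rewrite !in_itv/= => /andP[_ uc] /andP[].
  by rewrite leNgt uc.
congr (_ + _); last first.
  rewrite -(IH (c + p i 0))//; apply: eq_Rintegral => u; rewrite inE/= in_itv/= => /andP[cu _].
  by rewrite ltNge cu.
rewrite -[RHS]mulrC; transitivity (\int[lebesgue_measure]_(u in `[c, (c + p i 0)[) F (Some i)).
  by apply: eq_Rintegral => u; rewrite inE/= in_itv/= => /andP[_ ->].
rewrite Rintegral_cst//= lebesgue_measure_itv/= lte_fin ltrDl.
case: ltP => pi; first by rewrite -EFinB/= addrC addKr.
by congr (_ * _)%R; apply/eqP; rewrite eq_le p_ge0 pi.
Qed.

Lemma expectation_sample R n (p : 'cV[R]_n) (F : option 'I_n -> R) :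
  (forall i, 0 <= p i 0) -> \sum_i p i 0 = 1 ->
  expectation_of (sample p) F = \sum_i p i 0 * F (Some i).
Proof.
move=> p_ge0 p_sum /=.
transitivity (\int[lebesgue_measure]_(u in (`[0, 1]%classic : set R))
    F (first_above p u 0 (enum 'I_n))).
  by apply: eq_Rintegral => u _; apply: expectation_within (within_locate _ _ _ _) _ => _ <-.
(* The endpoint 1, where [None] may be returned, has measure zero. *)
rewrite -Rintegral_itv_bndo_bndc; last exact: integrable_first_above.
by rewrite Rintegral_first_above// ?big_enum//= add0r.
Qed.

Lemma within_sample R n (p : 'cV[R]_n) :
  within (sample p) (2 + 2 * n) (fun=> True).
Proof.
rewrite add2n /= => u _.
have := @within_locate R n p u 0%:R (enum 'I_n).
by rewrite size_enum_ord => /within_mono; apply.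
Qed.

(** * Values and costs of the subroutines *)

Lemma within_const R q : within (const q : prog R R) 1 (eq q%:R).
Proof. by []. Qed.

Lemma within_binary R o (v w : R) :
  within (binary o v w) 1 (eq (binary_sem o v w)).
Proof. by []. Qed.

Lemma within_tabulate R n (F : 'I_n -> prog R R) (c : 'I_n -> nat) v :
  (forall i, within (F i) (c i) (eq (v i))) ->
  within (tabulate F) (\sum_i c i) (eq (\col_i v i)).
Proof.
move=> Fv; rewrite -[X in within _ X]addn0.
suff tab : within (tabulate_tuple F) (\sum_i c i) (eq [tuple v i | i < n]).
  apply: within_let tab _ => /=.
  by apply/matrixP => i j; rewrite !mxE tnth_mktuple.
elim: n F c v Fv => [|n IH] F c v Fv /=; first by rewrite tuple0.
rewrite big_ord_recl; apply: within_let (Fv ord0) _.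
rewrite -[X in within _ X]addn0.
apply: within_let (IH _ _ _ (fun i => Fv (lift ord0 i))) _.
by apply/val_inj; rewrite /= enum_ordSl/= -map_comp.
Qed.

Lemma within_tabulate_cst R n (F : 'I_n -> prog R R) c v :
  (forall i, within (F i) c (eq (v i))) ->
  within (tabulate F) (n * c) (eq (\col_i v i)).
Proof.
by move=> /within_tabulate; rewrite sum_nat_const card_ord.
Qed.

Lemma within_repeat R S (f : S -> prog R S) (P : nat -> S -> Prop) c s k :
  P 0%N s -> (forall t s, P t s -> within (f s) c (P t.+1)) ->
  within (repeat k f s) (k * c) (P k).
Proof.
move=> P0 fP; suff loop (r : seq nat) t s' : P t s' ->
    within (fold (fun s _ => f s) s' r) (size r * c) (P (t + size r)%N).
  by have := loop (iota 0 k) _ _ P0; rewrite size_iota.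
elim: r t s' => [|i r IH] t s' Ps'; first by rewrite addn0.
rewrite mulSn addnS -addSn; apply: within_bind (fP _ _ Ps') _ => s'' Ps''.
exact: IH.
Qed.

Lemma within_sum_over R I (r : seq I) (F : I -> prog R R) (c : I -> nat) v :
  (forall i, within (F i) (c i) (eq (v i))) ->
  within (sum_over r F) (1 + \sum_(i <- r) (c i).+1) (eq (\sum_(i <- r) v i)).
Proof.
move=> Fv; apply: within_let (within_const _ _) _.
(* The initial value is exposed as an accumulator, over which the induction generalizes. *)
rewrite (_ : \sum_(i <- r) v i = 0%:R + \sum_(i <- r) v i); last first.
  by rewrite mulr0n add0r.
elim: r 0%:R => [|i r IH] s; first by rewrite !big_nil addr0.
rewrite !big_cons addrA -addn1 /=.
apply: within_let (within_let (Fv i) (within_binary _ _ _)) _.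
exact: IH.
Qed.

Lemma within_norm1 R n (x : 'cV[R]_n) :
  within (norm1 x) (1 + 2 * n) (eq (\sum_i `|x i 0|)).
Proof.
have := within_sum_over (enum 'I_n) (F := fun i => abs (x i 0)) (c := fun=> 1%N).
move/(_ (fun i => `|x i 0|)) => /(_ (fun _ => erefl)).
by rewrite !big_enum/= sum_nat_const card_ord mulnC.
Qed.

Lemma within_vec2 R o n (x y : 'cV[R]_n) :
  within (vec2 o x y) n (eq (\col_i binary_sem o (x i 0) (y i 0))).
Proof. by rewrite -[X in within _ X]muln1; exact: within_tabulate_cst. Qed.

Lemma within_scale R n (v : R) (x : 'cV[R]_n) :
  within (scale v x) n (eq (v *: x)).
Proof.
rewrite -[X in within _ X]muln1 (_ : v *: x = \col_i (v * x i 0)).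
  exact: within_tabulate_cst.
by apply/colP => i; rewrite !mxE.
Qed.

Lemma within_logv R n (x : 'cV[R]_n) :
  within (logv x) n (eq (\col_i ln (x i 0))).
Proof. by rewrite -[X in within _ X]muln1; exact: within_tabulate_cst. Qed.

Definition softmax_vec R n (v : 'cV[R]_n) : 'cV[R]_n :=
  \col_i (expR (v i 0) / \sum_j expR (v j 0)).

Lemma within_softmax R n (v : 'cV[R]_n) :
  within (softmax v) (4 * n + 1) (eq (softmax_vec v)).
Proof.
apply: (@within_leq _ _ _ (n * 1 + (1 + 2 * n + n * 1))); last lia.
apply: within_let.
  by apply: within_tabulate_cst => i; exact: (erefl (expR (v i 0))).
apply: within_let (within_norm1 _) _.
rewrite (_ : softmax_vec v = \col_i ((\col_i expR (v i 0)) i 0 /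
    \sum_j `|(\col_i expR (v i 0)) j 0|)).
  exact: within_tabulate_cst.
apply/colP => i; rewrite !mxE; congr (_ / _).
by apply: eq_bigr => j _; rewrite !mxE ger0_norm// expR_ge0.
Qed.

Lemma sum_size_row_nz R m n (A : 'M[R]_(m, n)) :
  (\sum_i size (row_nz (sparse_of A) i) = nnz A)%N.
Proof.
rewrite /nnz -sum1dep_card -(pair_big_dep xpredT (fun i j => A i j != 0) (fun _ _ => 1%N))/=.
by apply: eq_bigr => i _; rewrite size_filter -sum1_count big_enum_cond.
Qed.

Lemma sum_size_col_nz R m n (A : 'M[R]_(m, n)) :
  (\sum_j size (col_nz (sparse_of A) j) = nnz A)%N.
Proof.
rewrite -sum_size_row_nz /=; under eq_bigr do rewrite size_filter -sum1_count big_mkcond.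
under [RHS]eq_bigr do rewrite size_filter -sum1_count big_mkcond.
rewrite (eq_bigr (fun j => \sum_i if A i j != 0%R then 1 else 0)%N); last first.
  by move=> j _; rewrite big_enum.
rewrite exchange_big; apply: eq_bigr => i _.
by rewrite big_enum.
Qed.

Lemma within_mulA R m n (A : 'M[R]_(m, n)) (x : 'cV[R]_n) :
  within (Defs.mulA (sparse_of A) x) (m + 2 * nnz A) (eq (A *m x)).
Proof.
have -> : A *m x = \col_i \sum_(j <- row_nz (sparse_of A) i) A i j * x j 0.
  apply/colP => i; rewrite !mxE/= big_filter big_enum_cond/= [RHS]big_mkcond.
  by apply: eq_bigr => j _; case: eqP => // ->; rewrite mul0r.
apply: within_leq.
  by apply: within_tabulate => i; apply: within_sum_over => j; exact: within_binary.
rewrite big_split/= sum_nat_const card_ord muln1 leq_add2l -sum_size_row_nz.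
by rewrite big_distrr/= leq_sum// => i _; rewrite big_const_seq count_predT iter_addn addn0.
Qed.

Lemma within_mulAT R m n (A : 'M[R]_(m, n)) (y : 'cV[R]_m) :
  within (mulAT (sparse_of A) y) (n + 2 * nnz A) (eq (A^T *m y)).
Proof.
have -> : A^T *m y = \col_j \sum_(i <- col_nz (sparse_of A) j) A i j * y i 0.
  apply/colP => j; rewrite !mxE/= big_filter big_enum_cond/= [RHS]big_mkcond.
  by apply: eq_bigr => i _; rewrite mxE; case: eqP => // ->; rewrite mul0r.
apply: within_leq.
  by apply: within_tabulate => i; apply: within_sum_over => j; exact: within_binary.
rewrite big_split/= sum_nat_const card_ord muln1 leq_add2l -sum_size_col_nz.
by rewrite big_distrr/= leq_sum// => i _; rewrite big_const_seq count_predT iter_addn addn0.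
Qed.

Lemma within_log R (v : R) : within (log v) 1 (eq (ln v)).
Proof. by []. Qed.

Lemma within_neg R (v : R) : within (neg v) 1 (eq (- v)).
Proof. by []. Qed.

Lemma within_abs R (v : R) : within (abs v) 1 (eq `|v|).
Proof. by []. Qed.

Lemma within_less R (v w : R) : within (less v w) 1 (eq (v < w)).
Proof. by []. Qed.

Lemma within_ceil R (v : R) : within (ceil v) 1 (eq (ceil_sem v)).
Proof. by []. Qed.

(** The running maximum is described by its set of upper bounds, a form in which nested folds
    compose. *)
Lemma within_fold_max R I (F : I -> R) (L : R) (r : seq I) :
  within (fold (fun L j => let* a := abs (F j) in let* b := less L a in
      Ret (if b then a else L)) L r) (2 * size r)
    (fun L' => forall b, (L' <= b) = (L <= b) && all (fun j => `|F j| <= b) r).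
Proof.
elim: r L => [|j r IH] L; first by move=> b; rewrite andbT.
rewrite (mulnS 2 (size r)); apply: within_mono (IH _) (leqnn _) _ => L' L'E b.
rewrite L'E /= andbA; congr (_ && _).
by case: ltP => L_Fj; [rewrite andb_idl// | rewrite andb_idr//] => ?;
  [apply: le_trans (ltW _) _; eassumption | exact: le_trans L_Fj _].
Qed.

Lemma within_max_norm R m n (A : 'M[R]_(m, n)) :
  within (max_norm (sparse_of A)) (1 + 2 * nnz A) (eq (mx_norm A)).
Proof.
apply: within_let (within_const _ _) _.
suff fold_rows (L : R) (r : seq 'I_m) :
  within (fold (fun L i => fold (fun L j =>
      let* a := abs (entry (sparse_of A) i j) in
      let* b := less L a in
      Ret (if b then a else L)) L (row_nz (sparse_of A) i)) L r)
    (\sum_(i <- r) 2 * size (row_nz (sparse_of A) i))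
    (fun L' => forall b, (L' <= b) = (L <= b) &&
      all (fun i => all (fun j => `|A i j| <= b) (row_nz (sparse_of A) i)) r).
  apply: within_mono (fold_rows _ _) _ _.
    by rewrite -sum_size_row_nz big_distrr big_enum.
  move=> L' L'E; rewrite mx_normrE.
  (* Two numbers with the same upper bounds are equal. *)
  suff le_iff b : (\big[Num.max/0]_ij `|A ij.1 ij.2| <= b) = (L' <= b).
    by apply/le_anti; rewrite -le_iff lexx le_iff lexx.
  rewrite L'E mulr0n; apply/bigmax_leP/andP => -[b_ge0 A_le]; split => //.
    by apply/allP => i _; apply/allP => j _; exact: (A_le (i, j)).
  (* Zero entries are not scanned; they are bounded because the fold starts at 0. *)
  move=> [i j] _ /=; have [->|Aij] := eqVneq (A i j) 0; first by rewrite normr0.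
  move/allP: A_le => /(_ i (mem_enum _ i))/allP; apply.
  by rewrite mem_filter Aij mem_enum.
elim: r L => [|i r IH] L; first by move=> b; rewrite andbT.
rewrite big_cons; apply: within_bind (within_fold_max _ _ _) _ => L' L'E.
by apply: within_mono (IH _) (leqnn _) _ => L'' L''E b; rewrite L''E L'E /= andbA.
Qed.

Lemma within_estimate R o m n (B : 'I_m -> 'I_n -> R) (g0 : 'cV[R]_n) (w w0 : 'cV[R]_m) :
  within (estimate o B g0 w w0) (7 * m + 2 * n + 6) (fun=> True).
Proof.
(* The nesting of the sum follows the sequence of instructions, one summand for each. *)
apply: (@within_leq _ _ _ (m + ((1 + 2 * m) + (1 + (1 + (m * 2 + (2 + 2 * m + (1 + n * 2)))))))); last lia.
apply: within_let (within_vec2 _ _ _) _.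
apply: within_let (within_norm1 _) _.
apply: within_let (within_const _ _) _.
apply: within_let (within_less _ _) _.
case: ifP => // _.
apply: within_let.
  by apply: within_tabulate_cst => i; apply: within_let (within_abs _) _; exact: within_binary.
apply: within_bind (within_sample _) _ => -[i _|//].
apply: within_let (within_binary _ _ _) _.
apply: within_mono _ (leqnn _) (fun _ _ => I).
by apply: within_tabulate_cst => j; apply: within_let (within_binary _ _ _) _; exact: within_binary.
Qed.

(** Unbiasedness as an inequality: an affine majorant of [F] on the possible estimates integrates to
    its value at their mean. Sampling proportionally to the absolute differences keeps every outcome
    within [L] times their sum. The sign [s] serves both players. *)
Lemma expectation_estimate_le R o (s L kappa : R) m n (B : 'I_m -> 'I_n -> R)
    (g0 v : 'cV[R]_n) (w w0 : 'cV[R]_m) (F : 'cV[R]_n -> R) :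
  (forall a b, binary_sem o a b = a + s * b) -> `|s| = 1 ->
  (forall i j, `|B i j| <= L) ->
  (forall g : 'cV[R]_n, (forall j, `|g j 0 - g0 j 0| <= L * \sum_i `|w i 0 - w0 i 0|) ->
    F g <= kappa + \sum_j v j 0 * (g j 0 - g0 j 0)) ->
  expectation_of (estimate o B g0 w w0) F <=
  kappa + \sum_j v j 0 * (s * \sum_i B i j * (w i 0 - w0 i 0)).
Proof.
move=> o_s s1 BL F_le; rewrite /estimate (expectation_let _ _ (within_vec2 _ _ _)).
rewrite (expectation_let _ _ (within_norm1 _)).
rewrite (expectation_let _ _ (within_const _ _)).
rewrite (expectation_let _ _ (within_less _ _)).
under eq_bigr do rewrite mxE /=.
set D := \sum_i _ in F_le *.
have D_ge0 : 0 <= D by apply: sumr_ge0.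
(* If the total difference is zero, the estimate is [g0] and its mean increment vanishes too. *)
case: ltP => D0; last first.
  have {D0} D0 : D = 0 by apply/eqP; rewrite eq_le D0 D_ge0.
  have w_w0 i : w i 0 - w0 i 0 = 0.
    apply/normr0_eq0; have /eqP := D0; rewrite psumr_eq0// => /allP.
    by move=> /(_ i); rewrite mem_index_enum => /(_ isT)/eqP.
  apply: le_trans (F_le _ _) _ => [j|].
    by rewrite subrr normr0 D0 mulr0.
  rewrite lerD2l le_eqVlt; apply/orP; left; apply/eqP; apply: eq_bigr => j _.
  by rewrite big1 ?subrr ?mulr0// => i _; rewrite w_w0 mulr0.
rewrite (@expectation_let _ _ _ _ _ (m * 2)%N (\col_i (`|w i 0 - w0 i 0| / D))); last first.
  apply: within_tabulate_cst => i.
  by rewrite mxE; apply: within_let (within_abs _) _; exact: within_binary.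
set p := \col_i _.
have p_ge0 i : 0 <= p i 0 by rewrite mxE divr_ge0.
have p_sum : \sum_i p i 0 = 1.
  by under eq_bigr do rewrite mxE; rewrite -mulr_suml divff// gt_eqF.
rewrite expectation_bind expectation_sample//.
pose next i := \col_j (g0 j 0 + s * (B i j * ((w i 0 - w0 i 0) / p i 0))).
(* An index of probability zero has zero difference, so the convention that division by 0 gives 0 is
   consistent. *)
have p_cancel i : p i 0 * ((w i 0 - w0 i 0) / p i 0) = w i 0 - w0 i 0.
  have [pi0|pi_neq0] := eqVneq (p i 0) 0; last by rewrite mulrC divfK.
  rewrite pi0 mul0r; apply/esym/normr0_eq0; apply/eqP.
  by move/eqP: pi0; rewrite mxE mulf_eq0 invr_eq0 (gt_eqF D0) orbF.
have ratio_le i : `|(w i 0 - w0 i 0) / p i 0| <= D.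
  have [pi0|pi_neq0] := eqVneq (p i 0) 0; first by rewrite pi0 invr0 mulr0 normr0.
  have pi_gt0 : 0 < p i 0 by rewrite lt_def pi_neq0 p_ge0.
  rewrite normrM normfV (ger0_norm (p_ge0 i)) ler_pdivrMr//.
  by rewrite mxE mulrC divfK// gt_eqF.
(* The affine majorant at the mean is the average of its values at the outcomes [next i]. *)
have -> : kappa + \sum_j v j 0 * (s * \sum_i B i j * (w i 0 - w0 i 0)) =
    \sum_i p i 0 * (kappa + \sum_j v j 0 * (next i j 0 - g0 j 0)).
  under [RHS]eq_bigr do rewrite mulrDr; rewrite big_split/= -mulr_suml p_sum mul1r.
  congr (_ + _); under eq_bigr do rewrite mulr_sumr mulr_sumr.
  rewrite exchange_big; apply: eq_bigr => i _; rewrite mulr_sumr.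
  apply: eq_bigr => j _; rewrite [next i j 0]mxE -{1}(p_cancel i).
  by move: (_ / p i 0) => q; ring.
apply: ler_sum => i _; apply: ler_wpM2l => //.
rewrite (@expectation_let _ _ _ _ _ 1%N ((w i 0 - w0 i 0) / p i 0)); last by rewrite /= mxE.
rewrite (@expectation_within _ _ _ (n * 2) (eq (next i)) _ (F (next i))).
- apply: F_le => j; rewrite mxE addrC addKr normrM s1 mul1r normrM.
  exact: ler_pM (normr_ge0 _) (normr_ge0 _) (BL i j) (ratio_le i).
- apply: within_tabulate_cst => j; rewrite -o_s.
  apply: within_let (within_binary _ _ _) _; exact: within_binary.
- by move=> _ <-.
Qed.

(** For positive [x] and [x0], the minimizer over the simplex of
    [eta <g, y> + kl y x + h * kl y x0]. With [h = 0] it is a mirror descent step, used for the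
    ghost sequence and the outer update. *)
Definition prox R n (eta h : R) (x x0 g : 'cV[R]_n) : 'cV[R]_n :=
  softmax_vec (\col_i ((1 + h)^-1 * (ln (x i 0) + h * ln (x0 i 0) - eta * g i 0))).

Lemma within_inner_update R n (eta h : R) (x x0 g : 'cV[R]_n) :
  within (inner_update eta h x x0 g) (11 * n + 4) (eq (prox eta h x x0 g)).
Proof.
apply: (@within_leq _ _ _ (1 + (1 + (1 + (n + (n + (n + (n + (n + (n + (n + (4 * n + 1)))))))))))); last lia.
apply: within_let (within_const _ _) _.
apply: within_let (within_binary _ _ _) _.
apply: within_let (within_binary _ _ _) _.
apply: within_let (within_logv _) _.
apply: within_let (within_logv _) _.
apply: within_let (within_scale _ _) _.
apply: within_let (within_vec2 _ _ _) _.
apply: within_let (within_scale _ _) _.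
apply: within_let (within_vec2 _ _ _) _.
apply: within_let (within_scale _ _) _.
rewrite /prox; set v := \col_i (_ * _); set v' := _ *: _.
have -> : v = v' by apply/colP => i; rewrite !mxE /= mul1r.
exact: within_softmax.
Qed.

(** * Relative entropy and entropic proximal steps *)

Definition positive_distribution R n (x : 'cV[R]_n) : Prop :=
  (forall i, 0 < x i 0) /\ \sum_i x i 0 = 1.

Definition distribution R n (x : 'cV[R]_n) : Prop :=
  (forall i, 0 <= x i 0) /\ \sum_i x i 0 = 1.

Lemma positive_distributionW R n (x : 'cV[R]_n) :
  positive_distribution x -> distribution x.
Proof. by move=> [x_gt0 ?]; split => // i; exact: ltW. Qed.

Lemma distribution_simplex R n (x : 'cV[R]_n) : simplex x <-> distribution x.
Proof.
by split=> -[x_ge0 x_sum]; split => //; rewrite -[RHS]x_sum; apply: eq_bigr => i _;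
  rewrite ger0_norm.
Qed.

Definition dist1 R n (x y : 'cV[R]_n) : R := \sum_i `|x i 0 - y i 0|.

Definition dot R n (u v : 'cV[R]_n) : R := \sum_i u i 0 * v i 0.

Lemma dotC R n (u v : 'cV[R]_n) : dot u v = dot v u.
Proof. by apply: eq_bigr => i _; rewrite mulrC. Qed.

Lemma dotDr R n (u v w : 'cV[R]_n) : dot u (v + w) = dot u v + dot u w.
Proof. by rewrite /dot -big_split; apply: eq_bigr => i _; rewrite mxE mulrDr. Qed.

Lemma dotZr R n (a : R) (u v : 'cV[R]_n) : dot u (a *: v) = a * dot u v.
Proof. by rewrite /dot mulr_sumr; apply: eq_bigr => i _; rewrite mxE mulrCA. Qed.

Lemma dotNr R n (u v : 'cV[R]_n) : dot u (- v) = - dot u v.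
Proof. by rewrite -scaleN1r dotZr mulN1r. Qed.

Lemma dotDl R n (u v w : 'cV[R]_n) : dot (u + v) w = dot u w + dot v w.
Proof. by rewrite -!(dotC w) dotDr. Qed.

Lemma dotZl R n (a : R) (u v : 'cV[R]_n) : dot (a *: u) v = a * dot u v.
Proof. by rewrite -!(dotC v) dotZr. Qed.

Lemma dotNl R n (u v : 'cV[R]_n) : dot (- u) v = - dot u v.
Proof. by rewrite -!(dotC v) dotNr. Qed.

Lemma dot_mulmx R m n (A : 'M[R]_(m, n)) (y : 'cV[R]_m) (x : 'cV[R]_n) :
  dot y (A *m x) = dot (A^T *m y) x.
Proof.
rewrite /dot; under eq_bigr do rewrite mxE mulr_sumr.
rewrite exchange_big; apply: eq_bigr => j _; rewrite mxE mulr_suml.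
by apply: eq_bigr => i _; rewrite mxE; ring.
Qed.

Lemma normr_mulmx_le R m n (A : 'M[R]_(m, n)) (L : R) (x y : 'cV[R]_n) i :
  (forall i j, `|A i j| <= L) -> `|(A *m (x - y)) i 0| <= L * dist1 x y.
Proof.
move=> AL; rewrite mxE /dist1 mulr_sumr; apply: le_trans (ler_norm_sum _ _ _) _.
by apply: ler_sum => j _; rewrite normrM !mxE ler_wpM2r.
Qed.

(* [ln 0 = 0], so that [kl u x] is meaningful when coordinates of [u] vanish. *)
Definition kl R n (u x : 'cV[R]_n) : R :=
  \sum_i u i 0 * (ln (u i 0) - ln (x i 0)).

(* The difference of the two sides vanishes at 1 and has derivative
   [(t - 1)^3 / (t^2 (t + 2)^2)]. *)
Lemma ln_ge_rational R (t : R) : 0 < t ->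
  5 / 2 - t^-1 / 4 - (t + 2)^-1 * (27 / 4) <= ln t.
Proof.
move=> t0.
pose f (s : R) : R := ln s + 4^-1 * s^-1 + 27 / 4 * (s + 2)^-1.
pose df (s : R) : R := (s - 1) ^+ 3 / (s ^+ 2 * (s + 2) ^+ 2).
have f_df (s : R) : 0 < s -> is_derive s 1 f (df s).
  move=> s0.
  have ds := is_derive1_ln s0.
  have s_neq0 : s != 0 by rewrite gt_eqF.
  have s2_neq0 : s + 2 != 0 by rewrite gt_eqF// addr_gt0.
  have dV := is_deriveV s_neq0 (is_derive_id s (1 : R)).
  have dV2 := @is_deriveV _ (shift (2 : R)) _ _ _ s2_neq0 (is_derive_shift s 1 2).
  apply: is_derive_eq (is_deriveD (is_deriveD ds (is_deriveZ 4^-1 dV))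
    (is_deriveZ (27 / 4) dV2)) _.
  rewrite /df /GRing.scale /= !mulr1.
  by field; rewrite s2_neq0 s_neq0.
have f_cont (a b : R) : 0 < a -> {within `[a, b], continuous f}.
  move=> a0; apply: derivable_within_continuous => s.
  by rewrite in_itv/= => /andP[a_s _]; have [] := f_df s (lt_le_trans a0 a_s).
have f1 : f 1 = 5 / 2 by rewrite /f ln1; field.
rewrite -subr_ge0 (_ : _ - _ = f t - f 1); last by rewrite f1 /f; ring.
have denom_ge0 (s : R) : 0 <= (s ^+ 2 * (s + 2) ^+ 2)^-1.
  by rewrite invr_ge0 mulr_ge0// sqr_ge0.
have [t1|t1|->] := ltgtP t 1; last by rewrite subrr.
- have [s|c] := @MVT _ f df t 1 t1 _ (f_cont t 1 t0).
    by rewrite in_itv/= => /andP[t_s _]; exact: f_df (lt_trans t0 t_s).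
  rewrite in_itv/= => /andP[tc c1]; rewrite -[f t - _]opprB => ->.
  rewrite oppr_ge0 pmulr_lle0 ?subr_gt0// /df pmulr_lle0.
    by rewrite exprn_odd_le0// subr_le0 ltW.
  by rewrite invr_gt0 mulr_gt0// exprn_gt0//; lra.
- have [s|c] := @MVT _ f df 1 t t1 _ (f_cont 1 t ltr01).
    by rewrite in_itv/= => /andP[t_s _]; exact: f_df (lt_trans ltr01 t_s).
  rewrite in_itv/= => /andP[tc c1] ->.
  apply: mulr_ge0; last by rewrite subr_ge0 ltW.
  by rewrite /df mulr_ge0// exprn_ge0// subr_ge0 ltW.
Qed.

(** For [p > 0], the rational lower bound on [ln (p / q)], multiplied by [p], gives exactly the left
    side. The correction [- p + q] sums to zero over two distributions. *)
Lemma relative_entropy_term_ge R (p q : R) : 0 <= p -> 0 < q ->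
  3 * (p - q) ^+ 2 / (2 * p + 4 * q) <= p * (ln p - ln q) - p + q.
Proof.
rewrite le_eqVlt => /predU1P[<- q0|p0 q0].
  have -> : 3 * (0 - q) ^+ 2 / (2 * 0 + 4 * q) = 3 / 4 * q by field; rewrite gt_eqF.
  by nra.
have pq0 : 0 < p + 2 * q by lra.
have := ln_ge_rational (divr_gt0 p0 q0); rewrite ln_div ?posrE//.
move=> /(ler_wpM2l (ltW p0)) ln_ge; rewrite -subr_ge0 in ln_ge; rewrite -subr_ge0.
apply: le_trans ln_ge _; rewrite le_eqVlt; apply/orP; left; apply/eqP.
field; rewrite !gt_eqF//; lra.
Qed.

Lemma pinsker R n (u x : 'cV[R]_n) :
  distribution u -> positive_distribution x -> dist1 u x ^+ 2 / 2 <= kl u x.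
Proof.
move=> [u_ge0 u_sum] [x_gt0 x_sum]; set D := dist1 u x.
(* AM-GM applied to the square over its weight. The weights [2 u + 4 x] sum to 6, so the left sides
   add up to [D^2 - D^2 / 2]. *)
have term_ge i : D * `|u i 0 - x i 0| - D ^+ 2 / 12 * (2 * u i 0 + 4 * x i 0) <=
    u i 0 * (ln (u i 0) - ln (x i 0)) - u i 0 + x i 0.
  apply: le_trans (relative_entropy_term_ge (u_ge0 i) (x_gt0 i)).
  have ui := u_ge0 i; have xi := x_gt0 i.
  have w0 : 0 < 2 * u i 0 + 4 * x i 0 by lra.
  rewrite ler_pdivlMr// -(real_normK (num_real (u i 0 - x i 0))).
  have := sqr_ge0 (D / 6 * (2 * u i 0 + 4 * x i 0) - `|u i 0 - x i 0|).
  nra.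
have : \sum_i (D * `|u i 0 - x i 0| - D ^+ 2 / 12 * (2 * u i 0 + 4 * x i 0)) <=
    \sum_i (u i 0 * (ln (u i 0) - ln (x i 0)) - u i 0 + x i 0).
  by apply: ler_sum => i _; exact: term_ge.
rewrite sumrB -!mulr_sumr !big_split/= sumrN -!mulr_sumr u_sum x_sum -/(kl u x) -/(dist1 u x) -/D.
lra.
Qed.

Lemma kl_ge0 R n (u x : 'cV[R]_n) :
  distribution u -> positive_distribution x -> 0 <= kl u x.
Proof.
by move=> u_d x_d; apply: le_trans (pinsker u_d x_d); rewrite divr_ge0// sqr_ge0.
Qed.

Lemma kl_id R n (x : 'cV[R]_n) : kl x x = 0.
Proof. by rewrite /kl big1// => i _; rewrite subrr mulr0. Qed.

(* AM-GM turns [B * dist1 u x] into the two terms of the right-hand side. *)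
Lemma fenchel_kl R n (B : R) (w u x : 'cV[R]_n) :
  distribution u -> positive_distribution x -> (forall i, `|w i 0| <= B) ->
  dot w (x - u) <= B ^+ 2 / 2 + kl u x.
Proof.
move=> u_d x_d wB; apply: le_trans (lerD (lexx _) (pinsker u_d x_d)).
apply: (@le_trans _ _ (B * dist1 u x)); last by have := sqr_ge0 (B - dist1 u x); nra.
rewrite /dist1 mulr_sumr; apply: ler_sum => i _; apply: le_trans (ler_norm _) _.
by rewrite normrM !mxE (distrC (u i 0)) ler_wpM2r.
Qed.

Lemma softmax_vec_positive R n (v : 'cV[R]_n) :
  (0 < n)%N -> positive_distribution (softmax_vec v).
Proof.
move=> n0; have Z0 : 0 < \sum_i expR (v i 0).
  rewrite (bigD1 (Ordinal n0))//= ltr_pwDl ?expR_gt0//.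
  by apply: sumr_ge0 => i _; exact: expR_ge0.
split=> [i|]; first by rewrite mxE divr_gt0// expR_gt0.
by under eq_bigr do rewrite mxE; rewrite -mulr_suml divff// gt_eqF.
Qed.

(* First-order optimality of [softmax_vec v] for maximizing [<v, .>] plus the
   entropy. *)
Lemma softmax_vec_optimal R n (v u : 'cV[R]_n) : (0 < n)%N -> \sum_i u i 0 = 1 ->
  \sum_i (softmax_vec v i 0 - u i 0) * (v i 0 - ln (softmax_vec v i 0)) = 0.
Proof.
move=> n0 u_sum; have [s_gt0 s_sum] := softmax_vec_positive v n0.
have Z0 : 0 < \sum_i expR (v i 0).
  by have := s_gt0 (Ordinal n0); rewrite mxE pmulr_rgt0 ?expR_gt0// invr_gt0.
under eq_bigr => i _ do
  rewrite [in ln _]mxE ln_div ?posrE ?expR_gt0// expRK subKr.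
by rewrite -mulr_suml sumrB s_sum u_sum subrr mul0r.
Qed.

(** The three-point identity of Bregman divergences: the terms [ln (u i 0)] cancel. *)
Lemma kl_three_points R n (u x y : 'cV[R]_n) :
  kl u x - kl u y - kl y x =
  \sum_i (y i 0 - u i 0) * (ln (x i 0) - ln (y i 0)).
Proof. by rewrite /kl -!sumrB; apply: eq_bigr => i _; ring. Qed.

Lemma prox_positive R n (eta h : R) (x x0 g : 'cV[R]_n) :
  (0 < n)%N -> positive_distribution (prox eta h x x0 g).
Proof. exact: softmax_vec_positive. Qed.

(** The three-point identities for the centers [x] and [x0], weighted by 1 and [h], combine into
    [1 + h] times the optimality condition of the softmax. It is an equality because the minimizer
    is interior. *)
Lemma prox_regret R n (eta h : R) (x x0 g u : 'cV[R]_n) :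
  let y := prox eta h x x0 g in
  (0 < n)%N -> 0 <= h -> \sum_i u i 0 = 1 ->
  eta * dot g (y - u) =
  kl u x - kl u y - kl y x + h * (kl u x0 - kl u y - kl y x0).
Proof.
move=> y n0 h0 u_sum; rewrite !kl_three_points; apply/eqP.
rewrite -subr_eq0 mulr_sumr mulr_sumr -opprB oppr_eq0 -big_split/= -sumrB; apply/eqP.
set v := \col_i ((1 + h)^-1 * (ln (x i 0) + h * ln (x0 i 0) - eta * g i 0)).
transitivity ((1 + h) * \sum_i (softmax_vec v i 0 - u i 0) *
    (v i 0 - ln (softmax_vec v i 0))); last by rewrite softmax_vec_optimal// mulr0.
rewrite mulr_sumr; apply: eq_bigr => i _; rewrite [v i 0]mxE [(y - u) i 0]mxE [(- u) i 0]mxE.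
rewrite -/v -/(prox eta h x x0 g) -/y.
by field; lra.
Qed.

(** * One step of the inner loop *)

Lemma expectation_estimate_Plus R m n (A : 'M[R]_(m, n)) (L kappa : R)
    (g0 v : 'cV[R]_n) (w w0 : 'cV[R]_m) (F : 'cV[R]_n -> R) :
  (forall i j, `|A i j| <= L) ->
  (forall g : 'cV[R]_n, (forall j, `|(g - g0) j 0| <= L * dist1 w w0) ->
    F g <= kappa + dot v (g - g0)) ->
  expectation_of (estimate Plus (entry (sparse_of A)) g0 w w0) F <=
  kappa + dot v (A^T *m (w - w0)).
Proof.
move=> AL F_le.
apply: le_trans (@expectation_estimate_le _ Plus 1 L kappa m n _ g0 v w w0 F _ _ _ _) _.
- by move=> a b /=; rewrite mul1r.
- by rewrite normr1.
- exact: AL.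
- move=> g g_le; rewrite [X in _ + X](_ : _ = dot v (g - g0)).
    by apply: F_le => j; rewrite !mxE.
  by apply: eq_bigr => j _; rewrite !mxE.
rewrite lerD2l le_eqVlt; apply/orP; left; apply/eqP; apply: eq_bigr => j _.
by rewrite mul1r !mxE; congr (_ * _); apply: eq_bigr => i _; rewrite !mxE.
Qed.

Lemma expectation_estimate_Minus R m n (A : 'M[R]_(m, n)) (L kappa : R)
    (g0 v : 'cV[R]_m) (w w0 : 'cV[R]_n) (F : 'cV[R]_m -> R) :
  (forall i j, `|A i j| <= L) ->
  (forall g : 'cV[R]_m, (forall i, `|(g - g0) i 0| <= L * dist1 w w0) ->
    F g <= kappa + dot v (g - g0)) ->
  expectation_of (estimate Minus (fun j i => entry (sparse_of A) i j) g0 w w0) F <=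
  kappa + dot v (- (A *m (w - w0))).
Proof.
move=> AL F_le.
apply: le_trans (@expectation_estimate_le _ Minus (-1) L kappa n m _ g0 v w w0 F _ _ _ _) _.
- by move=> a b /=; rewrite mulN1r.
- by rewrite normrN1.
- by move=> j i; exact: AL.
- move=> g g_le; rewrite [X in _ + X](_ : _ = dot v (g - g0)).
    by apply: F_le => j; rewrite !mxE.
  by apply: eq_bigr => j _; rewrite !mxE.
rewrite lerD2l le_eqVlt; apply/orP; left; apply/eqP; apply: eq_bigr => i _.
by rewrite mulN1r !mxE; congr (_ * - _); apply: eq_bigr => j _; rewrite !mxE.
Qed.

(* [g] estimates [g0 + a]; the ghost iterate [s] absorbs the error
   [a - (g - g0)] uniformly in [u]. *)
Lemma player_step R n (eta h B : R) (x x0 g g0 a a' s u : 'cV[R]_n) :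
  let x' := prox eta h x x0 g in
  let delta := a - (g - g0) in
  let s' := prox eta 0 s s delta in
  (0 < n)%N -> 0 <= eta -> 0 <= h ->
  positive_distribution x -> positive_distribution s -> distribution u ->
  (forall i, `|a i 0| <= B) -> (forall i, `|(g - g0) i 0| <= B) ->
  eta * dot (g0 + a') (x' - u) + eta * dot a (x - u) <=
  kl u x - kl u x' + h * (kl u x0 - kl x' x0) + eta * dot a' (x' - u) +
  (kl u s - kl u s') + eta * dot delta (x - s) + 5 / 2 * (eta ^+ 2 * B ^+ 2).
Proof.
move=> x' delta s' n0 eta0 h0 x_d s_d u_d aB gB.
have x'_d : positive_distribution x' by exact: prox_positive.
have s'_d : positive_distribution s' by exact: prox_positive.
have [_ u_sum] := u_d.
have regret := prox_regret eta x x0 g n0 h0 u_sum.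
have ghost_regret := prox_regret eta s s delta n0 (lexx 0) u_sum.
rewrite -/x' in regret; rewrite -/s' in ghost_regret.
have stability : eta * dot (g - g0) (x - x') <= (eta * B) ^+ 2 / 2 + kl x' x.
  rewrite -dotZl; apply: fenchel_kl => //; first exact: positive_distributionW.
  by move=> i; rewrite mxE normrM (ger0_norm eta0) ler_wpM2l.
(* [delta] is the difference of two vectors bounded by [B], hence the bound [2 * B]. *)
have ghost_stability : eta * dot delta (s - s') <= (eta * (2 * B)) ^+ 2 / 2 + kl s' s.
  rewrite -dotZl; apply: fenchel_kl => //; first exact: positive_distributionW.
  move=> i; rewrite mxE normrM (ger0_norm eta0) ler_wpM2l//.
  have -> : delta i 0 = a i 0 - (g - g0) i 0 by rewrite !mxE.
  by apply: le_trans (ler_normB _ _) _; have := aB i; have := gB i; lra.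
have kl_x' : 0 <= h * kl u x' by rewrite mulr_ge0// kl_ge0.
clearbody x' s'.
have -> : eta * dot (g0 + a') (x' - u) + eta * dot a (x - u) =
    eta * dot g (x' - u) + eta * dot a' (x' - u) + eta * dot delta (x - s) +
    (eta * dot delta (s - s') + eta * dot delta (s' - u)) +
    eta * dot (g - g0) (x - x').
  by rewrite /delta !(dotDl, dotDr, dotNl, dotNr); ring.
clearbody delta; rewrite regret ghost_regret.
(* The two stability terms contribute 1/2 and 4/2 times [(eta * B)^2], which makes 5/2. *)
have -> : eta ^+ 2 * B ^+ 2 = (eta * B) ^+ 2 by rewrite exprMn.
have : (eta * (2 * B)) ^+ 2 = 4 * (eta * B) ^+ 2 by ring.
lra.
Qed.

(** * The inner loop *)

Definition positive_strategies R n m (z : @strategies R n m) : Prop :=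
  positive_distribution z.1 /\ positive_distribution z.2.

Definition mixed_strategies R n m (z : @strategies R n m) : Prop :=
  distribution z.1 /\ distribution z.2.

Lemma positive_strategiesW R n m (z : @strategies R n m) :
  positive_strategies z -> mixed_strategies z.
Proof. by move=> [zx zy]; split; exact: positive_distributionW. Qed.

Definition divergence R n m (u z : @strategies R n m) : R :=
  kl u.1 z.1 + kl u.2 z.2.

Definition regret R m n (A : 'M[R]_(m, n)) (z u : @strategies R n m) : R :=
  dot u.2 (A *m z.1) - dot u.1 (A^T *m z.2).

Definition prox_strategies R n m (eta h : R) (z z0 g : @strategies R n m) :
    @strategies R n m :=
  (prox eta h z.1 z0.1 g.1, prox eta h z.2 z0.2 g.2).

Definition dots R n m (u v : @strategies R n m) : R := dot u.1 v.1 + dot u.2 v.2.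

Definition gradient R m n (A : 'M[R]_(m, n)) (z : @strategies R n m) :
    @strategies R n m :=
  (A^T *m z.2, - (A *m z.1)).

(* [g] is a possible outcome of the gradient estimator at [z] centered at
   [z0]. *)
Definition centered_estimate R m n (A : 'M[R]_(m, n)) (L : R)
    (z0 z g : @strategies R n m) : Prop :=
  (forall j, `|(g.1 - (gradient A z0).1) j 0| <= L * dist1 z.2 z0.2) /\
  (forall i, `|(g.2 - (gradient A z0).2) i 0| <= L * dist1 z.1 z0.1).

(* The regret of the sum [S] of the first [t] iterates; [s] is the ghost
   iterate and [c] the accumulated martingale. *)
Definition inner_invariant R m n (A : 'M[R]_(m, n)) (eta h : R)
    (z0 : @strategies R n m) (t : nat) (z S s : @strategies R n m) (c : R) : Prop :=
  [/\ positive_strategies z, positive_strategies s &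
   forall u, mixed_strategies u ->
     eta * regret A S u <= (2 + t%:R * h) * divergence u z0 - divergence u z -
       divergence u s - h * divergence z z0 +
       eta * dots (gradient A (z - z0)) (z - u) + c].

(** The coefficient 2 pays for the initial divergences of [u] from the iterate and from the ghost,
    both equal to [z0]. *)
Lemma inner_invariant_init R m n (A : 'M[R]_(m, n)) (eta h : R) (z0 : @strategies R n m) :
  positive_strategies z0 -> inner_invariant A eta h z0 0 z0 0 z0 0.
Proof.
move=> z0_d; split => // u _.
rewrite /regret /dots /gradient /divergence /= subrr /= !mulmx0 !kl_id.
have dot0 k (v : 'cV[R]_k) : dot v 0 = 0 by rewrite -(scale0r 0) dotZr mul0r.
by rewrite subrr mulmx0 oppr0 !(dotC 0) !dot0; lra.
Qed.

(** The sum of [player_step] for both players. Regret is charged at the new iterate while the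
    estimate is taken at the old one; the term [eta * dots (gradient A (z - z0)) (z - u)] of the
    invariant carries this mismatch and telescopes. *)
Lemma inner_invariant_step R m n (A : 'M[R]_(m, n)) (L eta h : R)
    (z0 : @strategies R n m) t (z S s g : @strategies R n m) (c : R) :
  let z' := prox_strategies eta h z z0 g in
  let delta := gradient A (z - z0) - (g - gradient A z0) in
  (0 < m)%N -> (0 < n)%N -> (forall i j, `|A i j| <= L) ->
  0 <= eta -> 0 <= h -> 5 * (eta ^+ 2 * L ^+ 2) <= h -> positive_strategies z0 ->
  inner_invariant A eta h z0 t z S s c -> centered_estimate A L z0 z g ->
  inner_invariant A eta h z0 t.+1 z' (S + z') (prox_strategies eta 0 s s delta)
    (c + eta * dots delta (z - s)).
Proof.
move=> z' delta m0 n0 AL eta0 h0 etaL [z0x_d z0y_d] [[zx_d zy_d] [sx_d sy_d] zS] [gx_le gy_le].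
split; [by split; exact: prox_positive | by split; exact: prox_positive |].
move=> u u_d; have [ux_d uy_d] := u_d.
have ATL j i : `|A^T j i| <= L by rewrite mxE.
have ax_le j : `|(A^T *m (z.2 - z0.2)) j 0| <= L * dist1 z.2 z0.2.
  exact: normr_mulmx_le.
have ay_le i : `|(- (A *m (z.1 - z0.1))) i 0| <= L * dist1 z.1 z0.1.
  by rewrite mxE normrN; exact: normr_mulmx_le.
have zx_dW := positive_distributionW zx_d.
have zy_dW := positive_distributionW zy_d.
(* The coupling is crossed: the error of one player is controlled by the displacement of the
   other. *)
have stepx := player_step z0.1 (A^T *m (z'.2 - z0.2)) n0 eta0 h0 zx_d sx_d ux_d ax_le gx_le.
have stepy := player_step z0.2 (- (A *m (z'.1 - z0.1))) m0 eta0 h0 zy_d sy_d uy_d ay_le gy_le.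
rewrite -/(z'.1) -/(z'.2) in stepx stepy.
have sum_regret : eta * regret A (S + z') u = eta * regret A S u +
    eta * dot ((gradient A z0).1 + A^T *m (z'.2 - z0.2)) (z'.1 - u.1) +
    eta * dot ((gradient A z0).2 - A *m (z'.1 - z0.1)) (z'.2 - u.2).
  have -> : (gradient A z0).1 + A^T *m (z'.2 - z0.2) = A^T *m z'.2.
    by rewrite -mulmxDr addrC subrK.
  have -> : (gradient A z0).2 - A *m (z'.1 - z0.1) = - (A *m z'.1).
    by rewrite -opprD -mulmxDr [z0.1 + _]addrC subrK.
  clearbody z'; rewrite /regret /= !mulmxDr !(dotDr, dotNr, dotNl, dotDl).
  rewrite -dot_mulmx (dotC (A *m z'.1) z'.2) (dotC (A^T *m z'.2) u.1).
  by rewrite (dotC (A *m z'.1) u.2); ring.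
(* By Pinsker each squared distance is at most twice a divergence, so 5/2 becomes the 5 of
   [etaL]. *)
have variance : 5 / 2 * (eta ^+ 2 * (L * dist1 z.2 z0.2) ^+ 2) +
    5 / 2 * (eta ^+ 2 * (L * dist1 z.1 z0.1) ^+ 2) <= h * divergence z z0.
  have V0 : 0 <= divergence z z0 by rewrite addr_ge0// kl_ge0.
  apply: le_trans (ler_wpM2r V0 etaL); rewrite !(exprMn _ L) !(mulrA (eta ^+ 2)).
  have : 0 <= eta ^+ 2 * L ^+ 2 by rewrite mulr_ge0// sqr_ge0.
  have := pinsker zx_dW z0x_d; have := pinsker zy_dW z0y_d; rewrite /divergence.
  move: (eta ^+ 2 * L ^+ 2) (kl _ _) (kl _ _) (_ ^+ 2) (_ ^+ 2) => e ky kx dy dx.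
  by move=> dy_le dx_le e0; nra.
have {zS} := zS u u_d.
rewrite -[dots (gradient A (z - z0)) _]/(dot (A^T *m (z.2 - z0.2)) (z.1 - u.1) +
  dot (- (A *m (z.1 - z0.1))) (z.2 - u.2)).
rewrite -[dots (gradient A (z' - z0)) _]/(dot (A^T *m (z'.2 - z0.2)) (z'.1 - u.1) +
  dot (- (A *m (z'.1 - z0.1))) (z'.2 - u.2)).
rewrite -[dots delta _]/(
  dot (A^T *m (z.2 - z0.2) - (g.1 - (gradient A z0).1)) (z.1 - s.1) +
  dot (- (A *m (z.1 - z0.1)) - (g.2 - (gradient A z0).2)) (z.2 - s.2)).
set s' := prox_strategies eta 0 s s delta; rewrite -[prox _ _ _ _ _]/(z'.1) in stepx.
rewrite -[prox _ _ _ _ _]/(s'.1) in stepx.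
rewrite -[prox _ _ _ _ _]/(z'.2) in stepy; rewrite -[prox _ _ _ _ _]/(s'.2) in stepy.
rewrite sum_regret -(natr1 t) /divergence in variance *.
clearbody z' s'; move: stepx stepy variance; clear.
lra.
Qed.

(** The two estimates are drawn one after the other, and for each the majorant is affine with slope
    [- e] times [z - s]. Their means cancel the gradient difference, so the martingale increment has
    expectation zero. *)
Lemma expectation_inner_step_le R m n (A : 'M[R]_(m, n)) (L eta h e c : R)
    (z0 z s : @strategies R n m) (F : @strategies R n m -> R) :
  (forall i j, `|A i j| <= L) ->
  (forall g, centered_estimate A L z0 z g ->
    F (prox_strategies eta h z z0 g) <=
    c + e * dots (gradient A (z - z0) - (g - gradient A z0)) (z - s)) ->
  expectation_of (inner_step (sparse_of A) eta h z0 (gradient A z0) z) F <= c.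
Proof.
move=> AL F_le; rewrite /inner_step expectation_bind.
set a := gradient A (z - z0) in F_le.
apply: le_trans (expectation_estimate_Plus (kappa := c + e * dot a.1 (z.1 - s.1))
  (v := - e *: (z.1 - s.1)) AL _) _; last first.
  by rewrite dotZl (dotC (z.1 - s.1)) -[A^T *m _]/(a.1); lra.
move=> gx gx_le; rewrite expectation_bind.
apply: le_trans (expectation_estimate_Minus
  (kappa := c + e * dot a.1 (z.1 - s.1) + dot (- e *: (z.1 - s.1)) (gx - (gradient A z0).1)
    + e * dot a.2 (z.2 - s.2))
  (v := - e *: (z.2 - s.2)) AL _) _; last first.
  by rewrite !dotZl (dotC (z.2 - s.2)) -[- (A *m _)]/(a.2); lra.
move=> gy gy_le.
rewrite (expectation_let _ _ (within_inner_update _ _ _ _ _)).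
rewrite (expectation_let _ _ (within_inner_update _ _ _ _ _)) /=.
apply: le_trans (F_le (gx, gy) (conj gx_le gy_le)) _.
rewrite -[dots _ _]/(dot (a.1 - (gx - (gradient A z0).1)) (z.1 - s.1) +
  dot (a.2 - (gy - (gradient A z0).2)) (z.2 - s.2)).
rewrite !dotZl (dotC (z.1 - s.1)) (dotC (z.2 - s.2)) !(dotDl a.1) !(dotDl a.2) !(dotNl (_ - _)).
lra.
Qed.

Lemma within_inner_step R m n (A : 'M[R]_(m, n)) (eta h : R)
    (z0 g0 z : @strategies R n m) : (0 < m)%N -> (0 < n)%N ->
  within (inner_step (sparse_of A) eta h z0 g0 z) (20 * (m + n) + 20)
    (@positive_strategies R n m).
Proof.
move=> m0 n0; apply: (@within_leq _ _ _ ((7 * m + 2 * n + 6) + ((7 * n + 2 * m + 6) +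
  ((11 * n + 4) + (11 * m + 4))))); last lia.
apply: within_bind (within_estimate _ _ _ _ _) _ => gx _.
apply: within_bind (within_estimate _ _ _ _ _) _ => gy _.
apply: within_let (within_inner_update _ _ _ _ _) _.
rewrite -[(11 * m + 4)%N]addn0; apply: within_let (within_inner_update _ _ _ _ _) _.
by split; exact: prox_positive.
Qed.

Lemma within_add_strategies R m n (z z' : @strategies R n m) :
  within (add_strategies z z') (n + m) (eq (z + z')).
Proof.
apply: within_let (within_vec2 _ _ _) _; rewrite -[X in within _ X]addn0.
apply: within_let (within_vec2 _ _ _) _ => /=.
by congr pair; apply/colP => i; rewrite !mxE.
Qed.

Lemma within_zero_strategies R m n :
  within (zero_strategies n m) (n + m) (eq (0 : @strategies R n m)).
Proof.
have within_fill k : within (fill k (const 0)) k (eq (0 : 'cV[R]_k)).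
  rewrite -[X in within _ X]muln1 (_ : 0 = \col_i (0%:R : R)).
    by apply: within_tabulate_cst => i; exact: within_const.
  by apply/colP => i; rewrite !mxE.
apply: within_let (within_fill n) _; rewrite -[X in within _ X]addn0.
exact: within_let (within_fill m) _.
Qed.

Lemma within_average R m n k (z : @strategies R n m) :
  within (average k z) (3 + (n + m)) (eq (k%:R^-1 *: z.1, k%:R^-1 *: z.2)).
Proof.
apply: (@within_leq _ _ _ (1 + (1 + (1 + (n + (m + 0)))))%N); last lia.
apply: within_let (within_const _ _) _.
apply: within_let (within_const _ _) _.
apply: within_let (within_binary _ _ _) _ => /=.
rewrite mul1r; apply: within_let (within_scale _ _) _.
exact: within_let (within_scale _ _) _.
Qed.

(** Backward induction on the remaining rounds: the bound is affine in [c], and the increment of [c]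
    has conditional mean zero, so every round preserves it. *)
Lemma expectation_inner_rounds_le R m n (A : 'M[R]_(m, n)) (L eta h kappa weight : R)
    (z0 : @strategies R n m) (F : @strategies R n m * @strategies R n m -> R)
    (r : seq nat) (t : nat) (z S s : @strategies R n m) (c : R) :
  (0 < m)%N -> (0 < n)%N -> (forall i j, `|A i j| <= L) ->
  0 <= eta -> 0 <= h -> 5 * (eta ^+ 2 * L ^+ 2) <= h -> positive_strategies z0 ->
  (forall z S s c, inner_invariant A eta h z0 (t + size r)%N z S s c ->
    F (z, S) <= kappa + weight * c) ->
  inner_invariant A eta h z0 t z S s c ->
  expectation_of (fold (fun zS _ =>
      let* z := inner_step (sparse_of A) eta h z0 (gradient A z0) zS.1 in
      let* s := add_strategies zS.2 z in
      Ret (z, s)) (z, S) r) F <= kappa + weight * c.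
Proof.
move=> m0 n0 AL eta0 h0 etaL z0_d.
elim: r t z S s c => [|i r IH] t z S s c F_le zS.
  by apply: (F_le z S s); rewrite addn0.
rewrite /= 2!expectation_bind.
apply: (expectation_inner_step_le (e := weight * eta) (s := s) AL) => g g_le.
rewrite (expectation_let _ _ (within_add_strategies _ _)) /=.
have := inner_invariant_step m0 n0 AL eta0 h0 etaL z0_d zS g_le.
move=> /(IH _ _ _ _ _ _)/le_trans; apply.
  by move=> z1 S1 s1 c1; rewrite addSnnS; exact: F_le.
by rewrite mulrDr mulrA addrA.
Qed.

(** The last mismatch term is split by [fenchel_kl] into a divergence of [u] from [z] and a
    quadratic term; the invariant subtracts the former, and [h * divergence z z0] covers the
    latter. *)
Lemma inner_invariant_final R m n (A : 'M[R]_(m, n)) (L eta h : R)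
    (z0 : @strategies R n m) T (z S s u : @strategies R n m) (c : R) :
  (forall i j, `|A i j| <= L) -> 0 <= eta -> 5 * (eta ^+ 2 * L ^+ 2) <= h ->
  positive_strategies z0 -> inner_invariant A eta h z0 T z S s c ->
  mixed_strategies u ->
  eta * regret A S u <= (2 + T%:R * h) * divergence u z0 + c.
Proof.
move=> AL eta0 etaL [z0x_d z0y_d] [[zx_d zy_d] [sx_d sy_d] zS] u_d.
have [ux_d uy_d] := u_d.
have ATL j i : `|A^T j i| <= L by rewrite mxE.
have fenchelx : eta * dot (A^T *m (z.2 - z0.2)) (z.1 - u.1) <=
    (eta * (L * dist1 z.2 z0.2)) ^+ 2 / 2 + kl u.1 z.1.
  rewrite -dotZl; apply: fenchel_kl => // j; rewrite mxE normrM (ger0_norm eta0).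
  by rewrite ler_wpM2l//; exact: normr_mulmx_le.
have fenchely : eta * dot (- (A *m (z.1 - z0.1))) (z.2 - u.2) <=
    (eta * (L * dist1 z.1 z0.1)) ^+ 2 / 2 + kl u.2 z.2.
  rewrite -dotZl; apply: fenchel_kl => // i; rewrite mxE normrM (ger0_norm eta0).
  by rewrite mxE normrN ler_wpM2l//; exact: normr_mulmx_le.
have variance : (eta * (L * dist1 z.2 z0.2)) ^+ 2 / 2 +
    (eta * (L * dist1 z.1 z0.1)) ^+ 2 / 2 <= h * divergence z z0.
  have zx_dW := positive_distributionW zx_d.
  have zy_dW := positive_distributionW zy_d.
  have V0 : 0 <= divergence z z0 by rewrite addr_ge0// kl_ge0.
  apply: le_trans (ler_wpM2r V0 etaL); rewrite !(mulrA eta) !exprMn.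
  have : 0 <= eta ^+ 2 * L ^+ 2 by rewrite mulr_ge0// sqr_ge0.
  have := pinsker zx_dW z0x_d; have := pinsker zy_dW z0y_d.
  move: V0; rewrite /divergence.
  move: (eta ^+ 2 * L ^+ 2) (kl _ _) (kl _ _) (_ ^+ 2) (_ ^+ 2) => e kx ky dx dy.
  by move=> V0 dy_le dx_le e0; nra.
have s_ge0 : 0 <= divergence u s by rewrite addr_ge0// kl_ge0.
have {zS} := zS u u_d.
rewrite -[dots _ _]/(dot (A^T *m (z.2 - z0.2)) (z.1 - u.1) +
  dot (- (A *m (z.1 - z0.1))) (z.2 - u.2)).
have -> : divergence u z = kl u.1 z.1 + kl u.2 z.2 by [].
move: fenchelx fenchely variance s_ge0; clear; lra.
Qed.

Lemma regretZ R m n (A : 'M[R]_(m, n)) (k : R) (z u : @strategies R n m) :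
  regret A (k *: z.1, k *: z.2) u = k * regret A z u.
Proof. by rewrite /regret /= -!scalemxAr !dotZr mulrBr. Qed.

Lemma regretD R m n (A : 'M[R]_(m, n)) (z z' u : @strategies R n m) :
  regret A (z + z') u = regret A z u + regret A z' u.
Proof. by rewrite /regret /= !mulmxDr !dotDr; ring. Qed.

Lemma within_negv R k (v : 'cV[R]_k) :
  within (tabulate (fun i => neg (v i 0))) k (eq (- v)).
Proof.
rewrite -[X in within _ X]muln1 (_ : - v = \col_i - v i 0).
  by apply: within_tabulate_cst => i; exact: within_neg.
by apply/colP => i; rewrite !mxE.
Qed.

(* Quantifying over [F] and [rho] bounds the expectation of a maximum over
   [u] without naming a random variable. *)
Lemma expectation_inner_loop_le R m n (A : 'M[R]_(m, n)) (L eta alpha kappa weight : R)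
    (T : nat) (z0 : @strategies R n m) (F : @strategies R n m -> R) :
  let h := eta * alpha / 2 in
  (0 < m)%N -> (0 < n)%N -> (forall i j, `|A i j| <= L) ->
  0 < eta -> 0 <= h -> 5 * (eta ^+ 2 * L ^+ 2) <= h -> 4 <= T%:R * (eta * alpha) ->
  positive_strategies z0 ->
  (forall zhalf rho,
    (forall u, mixed_strategies u ->
      regret A zhalf u <= alpha * divergence u z0 + rho) ->
    F zhalf <= kappa + weight * rho) ->
  expectation_of (inner_loop (sparse_of A) eta h T z0) F <= kappa.
Proof.
move=> h m0 n0 AL eta_gt0 h0 etaL T_ge z0_d F_le.
have T_gt0 : 0 < T%:R :> R.
  by rewrite ltr0n lt0n; apply: contraTneq T_ge => ->; rewrite mul0r -ltNge.
rewrite /inner_loop (expectation_let _ _ (within_mulAT _ _)).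
rewrite (expectation_let _ _ (within_mulA _ _)).
rewrite (expectation_let _ _ (within_negv _)).
rewrite (expectation_let _ _ (within_zero_strategies _ _ _)).
(* The martingale starts at 0; dividing by [eta * T] turns the scaled summed regret into the regret
   of the average. *)
rewrite expectation_bind -[leRHS]addr0 -[X in _ + X](mulr0 (weight * (eta * T%:R)^-1)).
apply: (expectation_inner_rounds_le (h := h) (L := L) (t := 0) (s := z0)) => //.
- exact: ltW.
- move=> z S s c; rewrite size_iota add0n => zS.
  change (expectation_of (average T S) F <= kappa + weight * (eta * T%:R)^-1 * c).
  rewrite (expectation_within (within_average _ _) (x := F (T%:R^-1 *: S.1, T%:R^-1 *: S.2))).
    rewrite -mulrA; apply: F_le => u u_d; rewrite regretZ.
    have u_ge0 : 0 <= divergence u z0.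
      by case: u_d z0_d => ux_d uy_d [z0x_d z0y_d]; rewrite addr_ge0// kl_ge0.
    have := inner_invariant_final AL (ltW eta_gt0) etaL z0_d zS u_d.
    move=> regret_le; rewrite ler_pdivrMl//.
    rewrite -(ler_pM2l eta_gt0); apply: le_trans regret_le _.
    have -> : eta * (T%:R * (alpha * divergence u z0 + (eta * T%:R)^-1 * c)) =
        T%:R * (eta * alpha) * divergence u z0 + c.
      by field; rewrite !gt_eqF.
    rewrite lerD2r; apply: ler_wpM2r => //.
    (* [T * h] is half of [T * (eta * alpha)], and by [T_ge] the other half is at least 2. *)
    by rewrite /h; lra.
  by move=> _ <-.
- exact: inner_invariant_init.
Qed.

(** The invariant of a running sum of [t] distributions; it places the averages in the simplex. *)
Definition total_mass R k (t : nat) (v : 'cV[R]_k) : Prop :=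
  (forall i, 0 <= v i 0) /\ \sum_i v i 0 = t%:R.

Lemma total_mass0 R k : total_mass 0 (0 : 'cV[R]_k).
Proof. by split=> [i|]; rewrite ?mxE// big1// => i _; rewrite mxE. Qed.

Lemma total_massD R k t (v x : 'cV[R]_k) :
  total_mass t v -> distribution x -> total_mass t.+1 (v + x).
Proof.
move=> [v0 vt] [x0 x1]; split=> [i|]; first by rewrite mxE addr_ge0.
by under eq_bigr do rewrite mxE; rewrite big_split/= vt x1 natr1.
Qed.

Lemma total_mass_average R k t (v : 'cV[R]_k) :
  (0 < t)%N -> total_mass t v -> distribution (t%:R^-1 *: v).
Proof.
move=> t0 [v0 vt]; split=> [i|]; first by rewrite mxE mulr_ge0// invr_ge0.
under eq_bigr do rewrite mxE.
by rewrite -mulr_sumr vt mulVf// pnatr_eq0 -lt0n.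
Qed.

Lemma within_inner_loop R m n (A : 'M[R]_(m, n)) (eta h : R) (T : nat)
    (z0 : @strategies R n m) : (0 < m)%N -> (0 < n)%N -> (0 < T)%N ->
  within (inner_loop (sparse_of A) eta h T z0)
    (4 * nnz A + 4 * (m + n) + 3 + T * (21 * (m + n) + 20))
    (@mixed_strategies R n m).
Proof.
move=> m0 n0 T0.
apply: (@within_leq _ _ _ ((n + 2 * nnz A) + ((m + 2 * nnz A) + (m + ((n + m) +
  (T * ((20 * (m + n) + 20) + ((n + m) + 0)) + (3 + (n + m)))))))); last lia.
apply: within_let (within_mulAT _ _) _.
apply: within_let (within_mulA _ _) _.
apply: within_let (within_negv _) _.
apply: within_let (within_zero_strategies _ _ _) _.
pose P (t : nat) (zS : @strategies R n m * @strategies R n m) :=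
  total_mass t zS.2.1 /\ total_mass t zS.2.2.
apply: (within_bind (Q := P T)); first apply: (within_repeat (P := P)).
- by split; exact: total_mass0.
- move=> t [z S] [Sx_t Sy_t]; apply: within_bind (within_inner_step _ _ _ _ _ _ m0 n0) _.
  move=> z' /positive_strategiesW[z'x_d z'y_d]; apply: within_let (within_add_strategies _ _) _.
  by split; exact: total_massD.
move=> [z S] [Sx_T Sy_T]; apply: within_mono (within_average _ _) (leqnn _) _ => _ <-.
by split; exact: total_mass_average.
Qed.

(** * The outer loop *)

Lemma within_outer_update R m n (A : 'M[R]_(m, n)) (alpha : R)
    (z zhalf : @strategies R n m) :
  within (outer_update (sparse_of A) alpha z zhalf) (4 * nnz A + 8 * (m + n) + 4)
    (eq (prox_strategies alpha^-1 0 z z (gradient A zhalf))).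
Proof.
apply: (@within_leq _ _ _ (1 + (1 + ((n + 2 * nnz A) + (n + (n + (n + ((4 * n + 1) +
  ((m + 2 * nnz A) + (m + (m + (m + ((4 * m + 1) + 0)))))))))))))%N; last lia.
apply: within_let (within_const _ _) _.
apply: within_let (within_binary _ _ _) _ => /=; rewrite mul1r.
apply: within_let (within_mulAT _ _) _.
apply: within_let (within_scale _ _) _.
apply: within_let (within_logv _) _.
apply: within_let (within_vec2 _ _ _) _.
apply: within_let (within_softmax _) _.
apply: within_let (within_mulA _ _) _.
apply: within_let (within_scale _ _) _.
apply: within_let (within_logv _) _.
apply: within_let (within_vec2 _ _ _) _.
apply: within_let (within_softmax _) _ => /=.
by congr pair; congr softmax_vec; apply/colP => i; rewrite !mxE addr0 invr1; ring.
Qed.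

Definition outer_invariant R m n (A : 'M[R]_(m, n)) (alpha : R)
    (z0 z S : @strategies R n m) (c : R) : Prop :=
  positive_strategies z /\
  forall u, mixed_strategies u ->
    regret A S u <= alpha * divergence u z0 - alpha * divergence u z + c.

(** The mirror step identity moves the regret of [zhalf] from [u] to [z'] and leaves
    [- alpha * divergence z' z], which cancels the bound assumed on the regret at [z']. *)
Lemma outer_invariant_step R m n (A : 'M[R]_(m, n)) (alpha : R)
    (z0 z zhalf S : @strategies R n m) (c rho : R) :
  let z' := prox_strategies alpha^-1 0 z z (gradient A zhalf) in
  (0 < m)%N -> (0 < n)%N -> 0 < alpha ->
  outer_invariant A alpha z0 z S c ->
  (forall u, mixed_strategies u -> regret A zhalf u <= alpha * divergence u z + rho) ->
  outer_invariant A alpha z0 z' (S + zhalf) (c + rho).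
Proof.
move=> z' m0 n0 alpha0 [z_d S_le] zhalf_le.
have z'_d : positive_strategies z' by split; exact: prox_positive.
split=> // u u_d; have [[_ ux_sum] [_ uy_sum]] := u_d.
have optx := prox_regret alpha^-1 z.1 z.1 (gradient A zhalf).1 n0 (lexx 0) ux_sum.
have opty := prox_regret alpha^-1 z.2 z.2 (gradient A zhalf).2 m0 (lexx 0) uy_sum.
rewrite -[prox _ _ _ _ _]/(z'.1) mul0r addr0 in optx.
rewrite -[prox _ _ _ _ _]/(z'.2) mul0r addr0 in opty.
(* The comparator [z'] depends on [zhalf], hence on the draws; this is why the inner bound is
   uniform in [u]. *)
have := S_le u u_d; have := zhalf_le z' (positive_strategiesW z'_d).
have regretE v : regret A zhalf v = - dots (gradient A zhalf) v.
  by rewrite /regret /dots /= dotNl (dotC v.2) (dotC v.1); ring.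
have -> : regret A (S + zhalf) u = regret A S u + regret A zhalf z' +
    alpha * (alpha^-1 * dot (gradient A zhalf).1 (z'.1 - u.1)) +
    alpha * (alpha^-1 * dot (gradient A zhalf).2 (z'.2 - u.2)).
  rewrite regretD !regretE /dots !(dotDr, dotNr) !mulVKf ?gt_eqF//; ring.
rewrite optx opty /divergence; clear; clearbody z'; lra.
Qed.

(** Backward induction again: the test function given to the inner loop is the expectation of the
    later rounds, and [c] accumulates the errors [rho]. *)
Lemma expectation_outer_rounds_le R m n (A : 'M[R]_(m, n)) (L eta alpha kappa weight : R)
    (T : nat) (z0 : @strategies R n m)
    (F : @strategies R n m * @strategies R n m -> R)
    (r : seq nat) (z S : @strategies R n m) (c : R) :
  let h := eta * alpha / 2 in
  (0 < m)%N -> (0 < n)%N -> (forall i j, `|A i j| <= L) ->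
  0 < alpha -> 0 < eta -> 0 <= h -> 5 * (eta ^+ 2 * L ^+ 2) <= h ->
  4 <= T%:R * (eta * alpha) ->
  (forall z S c, outer_invariant A alpha z0 z S c -> F (z, S) <= kappa + weight * c) ->
  outer_invariant A alpha z0 z S c ->
  expectation_of (fold (fun zS _ =>
      let* zhalf := inner_loop (sparse_of A) eta h T zS.1 in
      let* z := outer_update (sparse_of A) alpha zS.1 zhalf in
      let* s := add_strategies zS.2 zhalf in
      Ret (z, s)) (z, S) r) F <= kappa + weight * c.
Proof.
move=> h m0 n0 AL alpha0 eta0 h0 etaL T_ge F_le.
elim: r z S c => [|i r IH] z S c zS; first exact: F_le zS.
rewrite /= 2!expectation_bind.
have z_d : positive_strategies z by case: zS.
apply: (expectation_inner_loop_le (weight := weight)) AL _ _ _ _ z_d _ => //.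
move=> zhalf rho zhalf_le.
rewrite (expectation_let _ _ (within_outer_update _ _ _ _)).
rewrite (expectation_let _ _ (within_add_strategies _ _)) /=.
have := outer_invariant_step m0 n0 alpha0 zS zhalf_le.
by move=> /IH/le_trans; apply; rewrite mulrDr addrA.
Qed.

(** * The duality gap *)

Definition vertex R k (i : 'I_k) : 'cV[R]_k := \col_j (j == i)%:R.

Lemma vertex_distribution R k (i : 'I_k) : distribution (vertex R i).
Proof.
split=> [j|]; first by rewrite mxE ler0n.
under eq_bigr do rewrite mxE.
by rewrite (bigD1 i)//= eqxx big1 ?addr0// => j /negPf->.
Qed.

Lemma dot_vertex R k (i : 'I_k) (b : 'cV[R]_k) : dot (vertex R i) b = b i 0.
Proof.
rewrite /dot; under eq_bigr do rewrite mxE.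
by rewrite (bigD1 i)//= eqxx mul1r big1 ?addr0// => j /negPf->; rewrite mul0r.
Qed.

Lemma has_ubound_range R k (b : 'cV[R]_k) : has_ubound (range (fun i => b i 0)).
Proof.
exists (\sum_j `|b j 0|) => _ [i _ <-]; apply: le_trans (ler_norm _) _.
by rewrite (bigD1 i)//= lerDl sumr_ge0.
Qed.

(** A linear function on the simplex averages its coordinates, and the vertices attain each of
    them. *)
Lemma sup_dot_simplex R k (b : 'cV[R]_k) : (0 < k)%N ->
  sup [set dot v b | v in @simplex R k] = sup (range (fun i => b i 0)).
Proof.
move=> k0; set X := [set _ | _ in _]; set Y := range _.
have YX : Y `<=` X.
  move=> _ [i _ <-]; exists (vertex R i); last exact: dot_vertex.
  exact/distribution_simplex/vertex_distribution.
have Y0 : Y !=set0 by exists (b (Ordinal k0) 0); exists (Ordinal k0).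
have XY : ubound X (sup Y).
  move=> _ [v /distribution_simplex[v0 v1] <-].
  rewrite -[sup Y]mul1r -v1 mulr_suml; apply: ler_sum => i _.
  by apply: ler_wpM2l => //; apply: (ub_le_sup (has_ubound_range b)); exists i.
apply/le_anti/andP; split.
  by apply: ge_sup XY; case: Y0 => y /YX; exists y.
apply: ge_sup => // y /YX Xy; by apply: ub_le_sup => //; exists (sup Y).
Qed.

Lemma inf_dot_simplex R k (b : 'cV[R]_k) : (0 < k)%N ->
  inf [set dot v b | v in @simplex R k] = inf (range (fun i => b i 0)).
Proof.
move=> k0; rewrite /inf !image_comp.
rewrite (_ : [set _ | _ in _] = [set dot v (- b) | v in @simplex R k]); last first.
  by apply: eq_imagel => v _ /=; rewrite dotNr.
rewrite sup_dot_simplex//; congr (- sup _).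
by apply: eq_imagel => i _ /=; rewrite mxE.
Qed.

Lemma duality_gapE R m n (A : 'M[R]_(m, n)) (z : @strategies R n m) :
  (0 < m)%N -> (0 < n)%N -> duality_gap A z = coordinate_gap A z.
Proof.
move=> m0 n0; rewrite /duality_gap /coordinate_gap -sup_dot_simplex// -inf_dot_simplex//.
congr (sup _ - inf _); apply: eq_imagel => v _.
  by rewrite -mulmxA mxE; apply: eq_bigr => i _; rewrite mxE.
rewrite dot_mulmx trmxK dotC -mulmxA mxE.
by apply: eq_bigr => i _; rewrite mxE.
Qed.

(** Only pairs of vertices have to be tested, and their divergence from the uniform start is
    explicit. *)
Lemma coordinate_gap_le R m n (A : 'M[R]_(m, n)) (z : @strategies R n m) (B : R) :
  (0 < m)%N -> (0 < n)%N ->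
  (forall i j, regret A z (vertex R j, vertex R i) <= B) -> coordinate_gap A z <= B.
Proof.
move=> m0 n0 regret_le; rewrite /coordinate_gap lerBlDl -lerBlDr.
apply: lb_le_inf => [|_ [j _ <-]].
  by exists ((A^T *m z.2) (Ordinal n0) 0); exists (Ordinal n0).
rewrite lerBlDr -lerBlDl.
rewrite lerBlDl; apply: ge_sup => [|_ [i _ <-]].
  by exists ((A *m z.1) (Ordinal m0) 0); exists (Ordinal m0).
by have := regret_le i j; rewrite /regret /= !dot_vertex lerBlDl.
Qed.

Lemma kl_vertex_uniform R k (i : 'I_k) :
  kl (vertex R i) (\col_j k%:R^-1) = ln k%:R.
Proof.
rewrite /kl (bigD1 i)//= big1 ?addr0 => [|j /negPf ji].
  by rewrite !mxE eqxx ln1 mul1r sub0r lnV ?opprK// posrE ltr0n (leq_ltn_trans _ (ltn_ord i)).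
by rewrite !mxE ji mul0r.
Qed.

Lemma uniform_positive R k : (0 < k)%N ->
  positive_distribution (\col_(j < k) (k%:R^-1 : R)).
Proof.
move=> k0; split=> [i|]; first by rewrite mxE invr_gt0 ltr0n.
under eq_bigr do rewrite mxE.
by rewrite sumr_const card_ord -[RHS](@mulVf _ k%:R) ?pnatr_eq0 -?lt0n// mulr_natr.
Qed.

(** * Correctness and cost of the algorithm *)

Lemma within_uniform R k :
  within (fill k (div 1%:R k%:R)) k (eq (\col_(j < k) (k%:R^-1 : R))).
Proof.
rewrite -[X in within _ X]muln1; apply: within_tabulate_cst => i.
by rewrite -[_^-1]mul1r; exact: within_binary.
Qed.

Lemma ceil_sem_ge R (v : R) : 0 <= v -> v <= (ceil_sem v)%:R.
Proof.
move=> v0; apply: le_trans (Num.Theory.ceil_ge v) _.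
by rewrite /ceil_sem pmulrn gez0_abs// ceil_ge0 (lt_le_trans _ v0) ?ltrN10.
Qed.

Lemma ceil_sem_le R (v : R) : 0 <= v -> (ceil_sem v)%:R <= v + 1.
Proof.
move=> v0; rewrite /ceil_sem pmulrn gez0_abs ?ceil_ge0 ?(lt_le_trans _ v0) ?ltrN10//.
by rewrite -lerBlDr -[X in _ - X]/(1%:~R) -rmorphB/=; exact: ltW (ceilB1_lt v).
Qed.

Lemma within_algorithm R m n (A : 'M[R]_(m, n)) (eps alpha : R) :
  let K := ceil_sem (alpha * @log_size R m n / eps) in
  let T := ceil_sem (4 / (alpha / (10 * (mx_norm A * mx_norm A)) * alpha)) in
  (0 < m)%N -> (0 < n)%N -> (0 < K)%N -> (0 < T)%N ->
  within (algorithm A eps alpha)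
    (22 + 2 * nnz A + 3 * (m + n) +
      K * (8 * nnz A + 13 * (m + n) + 7 + T * (21 * (m + n) + 20)))
    (@mixed_strategies R n m).
Proof.
move=> K T m0 n0 K0 T0.
apply: (@within_leq _ _ _ ((1 + 2 * nnz A) + (1 + (1 + (1 + (1 + (1 + (1 + (1 + (1 + (1 +
  (1 + (1 + (1 + (1 + (1 + (1 + (1 + (1 + (1 + (n + (m + ((n + m) +
  (K * ((4 * nnz A + 4 * (m + n) + 3 + T * (21 * (m + n) + 20)) +
    ((4 * nnz A + 8 * (m + n) + 4) + ((n + m) + 0))) +
  (3 + (n + m))))))))))))))))))))))))))%N; last lia.
apply: within_let (within_max_norm _) _.
do 2! apply: within_let (within_const _ _) _.
apply: within_let (within_binary _ _ _) _.
apply: within_let (within_log _) _.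
do 2! apply: within_let (within_binary _ _ _) _.
apply: within_let (within_ceil _) _.
apply: within_let (within_const _ _) _.
do 4! apply: within_let (within_binary _ _ _) _.
apply: within_let (within_const _ _) _.
apply: within_let (within_binary _ _ _) _.
apply: within_let (within_ceil _) _.
apply: within_let (within_const _ _) _.
apply: within_let (within_binary _ _ _) _.
apply: within_let (within_const _ _) _.
do 2! apply: within_let (within_uniform _ _) _.
apply: within_let (within_zero_strategies _ _ _) _.
rewrite [binary_sem Times n%:R m%:R]/= -natrM -/(@log_size R m n).
rewrite -/K -/T.
pose P (t : nat) (zS : @strategies R n m * @strategies R n m) :=
  total_mass t zS.2.1 /\ total_mass t zS.2.2.
apply: (within_bind (Q := P K)); first apply: (within_repeat (P := P)).
- by split; exact: total_mass0.
- move=> t [z S] [Sx_t Sy_t]; apply: within_bind (within_inner_loop _ _ _ _ m0 n0 T0) _.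
  move=> zhalf [zx_d zy_d]; apply: within_let (within_outer_update _ _ _ _) _.
  apply: within_let (within_add_strategies _ _) _.
  by split; exact: total_massD.
move=> [z S] [Sx_K Sy_K]; apply: within_mono (within_average _ _) (leqnn _) _ => _ <-.
by split; exact: total_mass_average.
Qed.

Lemma entry_le_mx_norm R m n (A : 'M[R]_(m, n)) i j : `|A i j| <= mx_norm A.
Proof.
rewrite mx_normrE; apply: (le_bigmax _ (fun ij : 'I_m * 'I_n => `|A ij.1 ij.2|) (i, j)).
Qed.

Lemma mx_norm_gt0 R m n (A : 'M[R]_(m, n)) : (0 < nnz A)%N -> 0 < mx_norm A.
Proof.
move=> /card_gt0P[[i j]]; rewrite inE /= => Aij.
by apply: lt_le_trans (entry_le_mx_norm A i j); rewrite normr_gt0.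
Qed.

Lemma expectation_algorithm_le R m n (A : 'M[R]_(m, n)) (eps alpha : R) :
  (0 < m)%N -> (0 < n)%N -> 0 < mx_norm A -> 0 < eps -> 0 < alpha ->
  0 < @log_size R m n ->
  expectation_of (algorithm A eps alpha) (coordinate_gap A) <= eps.
Proof.
move=> m0 n0 L0 eps0 alpha0 log0; rewrite /algorithm /matrix_game.
rewrite (expectation_let _ _ (within_max_norm _)).
rewrite 2!(expectation_let _ _ (within_const _ _)).
rewrite (expectation_let _ _ (within_binary _ _ _)).
rewrite (expectation_let _ _ (within_log _)).
rewrite 2!(expectation_let _ _ (within_binary _ _ _)).
rewrite (expectation_let _ _ (within_ceil _)).
rewrite (expectation_let _ _ (within_const _ _)).
rewrite 4!(expectation_let _ _ (within_binary _ _ _)).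
rewrite (expectation_let _ _ (within_const _ _)).
rewrite (expectation_let _ _ (within_binary _ _ _)).
rewrite (expectation_let _ _ (within_ceil _)).
rewrite (expectation_let _ _ (within_const _ _)).
rewrite (expectation_let _ _ (within_binary _ _ _)).
rewrite (expectation_let _ _ (within_const _ _)).
rewrite 2!(expectation_let _ _ (within_uniform _ _)).
rewrite (expectation_let _ _ (within_zero_strategies _ _ _)).
rewrite [binary_sem Times n%:R m%:R]/= -natrM -/(@log_size R m n) expectation_bind.
set L := mx_norm A in L0 *; set K := ceil_sem _; set eta := binary_sem Divide alpha _.
set T := ceil_sem _; set z0 : @strategies R n m := (\col__ n%:R^-1, \col__ m%:R^-1).
have K_ge : alpha * @log_size R m n / eps <= K%:R.
  by apply: ceil_sem_ge; rewrite divr_ge0 ?mulr_ge0 ?ltW.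
have K0 : 0 < K%:R :> R by apply: lt_le_trans K_ge; rewrite divr_gt0 ?mulr_gt0.
have eta0 : 0 < eta by rewrite divr_gt0 ?mulr_gt0.
have T_ge : 4 <= T%:R * (eta * alpha).
  have ea0 : 0 < eta * alpha by rewrite mulr_gt0.
  rewrite -ler_pdivrMr//; apply: (@ceil_sem_ge _ (4 / (eta * alpha))).
  by rewrite divr_ge0// ltW.
have z0_d : positive_strategies z0 by split; exact: uniform_positive.
(* The step size [alpha / (10 L^2)] makes this an equality. *)
have etaL : 5 * (eta ^+ 2 * L ^+ 2) <= eta * alpha / 2.
  by rewrite le_eqVlt; apply/orP; left; apply/eqP; rewrite /eta /=; field; rewrite gt_eqF.
(* The weight [1 / K] comes from averaging, the final 0 is the initial accumulated error, and [K_ge]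
   bounds the rest by [eps]. *)
apply: (@le_trans _ _ (K%:R^-1 * (alpha * @log_size R m n) + K%:R^-1 * 0)); last first.
  by rewrite mulr0 addr0 ler_pdivrMl// -ler_pdivrMr.
apply: (expectation_outer_rounds_le (L := L) (z0 := z0)) => //.
- exact: entry_le_mx_norm.
- by rewrite divr_ge0// ltW// mulr_gt0.
- move=> z S c [z_d S_le].
  change (expectation_of (average K S) (coordinate_gap A) <=
    K%:R^-1 * (alpha * @log_size R m n) + K%:R^-1 * c).
  rewrite (expectation_within (within_average _ _)
    (x := coordinate_gap A (K%:R^-1 *: S.1, K%:R^-1 *: S.2))); last by move=> _ <-.
  apply: coordinate_gap_le => // i j.
  rewrite regretZ -mulrDr ler_pM2l ?invr_gt0//.
  have v_d : mixed_strategies (vertex R j, vertex R i).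
    by split; exact: vertex_distribution.
  apply: le_trans (S_le _ v_d) _; rewrite lerD2r lerBlDr.
  have -> : divergence (vertex R j, vertex R i) z0 = @log_size R m n.
    by rewrite /divergence /= !kl_vertex_uniform /log_size natrM lnM// posrE ltr0n.
  rewrite lerDl mulr_ge0 ?(ltW alpha0)//.
  by case: v_d z_d => ? ? [? ?]; rewrite addr_ge0// kl_ge0.
- split=> // u _; rewrite /regret /= !mulmx0 subrr addr0.
  by rewrite -[X in dot _ X](scale0r 0) dotZr mul0r -[X in dot _ X](scale0r 0) dotZr mul0r subrr.
Qed.

(** * Operation count and optimal parameter *)

Lemma log_size_gt0 R m n (A : 'M[R]_(m, n)) :
  (0 < m)%N -> (0 < n)%N -> (m + n <= nnz A)%N -> 0 < @log_size R m n.
Proof.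
move=> m0 n0 nnz_ge; rewrite ln_gt0// ltr1n.
(* Then [m + n <= m * n], which excludes [m = n = 1]. *)
have : (nnz A <= m * n)%N by apply: leq_trans (max_card _) _; rewrite card_prod !card_ord.
nia.
Qed.

(** Additive constants are absorbed through [s >= 2], and lone multiples of [s] through [s <= z]. *)
Lemma operation_count_le (z s K T : nat) : (2 <= s)%N -> (s <= z)%N ->
  (22 + 2 * z + 3 * s + K * (8 * z + 13 * s + 7 + T * (21 * s + 20)) <=
   16 * z + (K * (25 * z) + K * (T * (31 * s))))%N.
Proof.
move=> s2 sz; rewrite -mulnDr; apply: leq_add; first lia.
by rewrite leq_mul//; apply: leq_add; [lia | rewrite leq_mul//; lia].
Qed.

(** Rounding up [K] at most doubles [r] because [r >= 1], and the 1 added to [40 * e] costs a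
    multiple of [r * s <= r * z]. The largest coefficient is [2 * 40 * 31 = 2480]. *)
Lemma rounded_operation_count_le R (z s r e : R) (K T : nat) :
  0 <= s -> s <= z -> 1 <= r -> 0 <= e -> K%:R <= r + 1 -> T%:R <= 40 * e + 1 ->
  16 * z + (K%:R * (25 * z) + K%:R * (T%:R * (31 * s))) <= 2500 * ((z + s * e) * r).
Proof.
move=> s0 sz r1 e0 K_le T_le.
have KT_le : K%:R * T%:R <= 2 * r * (40 * e + 1) by apply: ler_pM => //; lra.
have := ler_wpM2r s0 KT_le.
have rz : r * s <= r * z by rewrite ler_wpM2l//; lra.
have Kz : K%:R * z <= 2 * r * z by apply: ler_wpM2r; lra.
have z_rz : z <= r * z by rewrite ler_peMl//; lra.
have se : 0 <= s * e * r by rewrite !mulr_ge0//; lra.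
move: (K%:R) (T%:R) Kz => K' T'; lra.
Qed.

Lemma time_algorithm_le R m n (A : 'M[R]_(m, n)) (eps alpha : R) u :
  (0 < m)%N -> (0 < n)%N -> (m + n <= nnz A)%N -> 0 < eps ->
  eps / log_size m n <= alpha -> tapes u ->
  simplex (result u (algorithm A eps alpha)).1 /\
  simplex (result u (algorithm A eps alpha)).2 /\
  (time u (algorithm A eps alpha))%:R <= 2500 * time_bound A eps alpha.
Proof.
move=> m0 n0 nnz_ge eps0 alpha_ge u_tape.
have log0 := log_size_gt0 m0 n0 nnz_ge.
have L0 : 0 < mx_norm A by apply: mx_norm_gt0; lia.
have alpha0 : 0 < alpha by apply: lt_le_trans alpha_ge; rewrite divr_gt0.
have := @within_algorithm R m n A eps alpha m0 n0.
set r := alpha * log_size m n / eps; set q := 4 / _.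
(* The lower bound on [alpha] says exactly that at least one outer round is called for before
   rounding. *)
have r1 : 1 <= r by rewrite /r ler_pdivlMr// mul1r -ler_pdivrMr.
have q0 : 0 < q by rewrite divr_gt0// mulr_gt0// divr_gt0// !mulr_gt0.
have qE : q = 40 * (mx_norm A ^+ 2 / alpha ^+ 2) by rewrite /q; field; rewrite !gt_eqF.
have K_le := ceil_sem_le (le_trans ler01 r1).
have K_ge := ceil_sem_ge (le_trans ler01 r1).
have T_le := ceil_sem_le (ltW q0); have T_ge := ceil_sem_ge (ltW q0).
have K0 : (0 < ceil_sem r)%N by rewrite -(ltr0n R); lra.
have T0 : (0 < ceil_sem q)%N by rewrite -(ltr0n R); lra.
move=> /(_ K0 T0) /within_run /(_ u_tape)[[zx_d zy_d] time_le].
split; first exact/distribution_simplex.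
split; first exact/distribution_simplex.
have s2 : (2 <= m + n)%N by rewrite -(addn1 1) leq_add.
move: (time u _) time_le => N time_le.
have := leq_trans time_le (operation_count_le _ _ s2 nnz_ge).
rewrite -(ler_nat R) => /le_trans; apply; rewrite natrD natrD 5!natrM [(31 * _)%:R]natrM.
rewrite /time_bound -/r -mulrA; apply: rounded_operation_count_le => //.
- by rewrite ler_nat.
- by rewrite divr_ge0// sqr_ge0.
- by rewrite -qE.
Qed.

(** Up to a constant factor the bound is [t + b^2 / t], convex for [t > 0] with minimizer [b], so
    over [t >= a] the minimizer is the larger of [a] and [b]. *)
Lemma time_bound_optimal_le R m n (A : 'M[R]_(m, n)) (eps : R) :
  (0 < m)%N -> (0 < n)%N -> (m + n <= nnz A)%N -> 0 < eps ->
  exists alpha, optimal_parameter A eps alpha /\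
    time_bound A eps alpha <= 2 * optimal_time_bound A eps.
Proof.
move=> m0 n0 nnz_ge eps0.
have log0 := log_size_gt0 m0 n0 nnz_ge.
have L0 : 0 < mx_norm A by apply: mx_norm_gt0; lia.
have z0 : 0 < (nnz A)%:R :> R by rewrite ltr0n; lia.
have s0 : 0 < (m + n)%:R :> R by rewrite ltr0n; lia.
rewrite /optimal_parameter /time_bound /optimal_time_bound.
move: (mx_norm A) (log_size m n) (nnz A)%:R (m + n)%:R L0 log0 z0 s0.
move=> L log z s L0 log0 z0 s0 {nnz_ge m0 n0 A}.
pose a := eps / log; have a0 : 0 < a by rewrite divr_gt0.
pose b := L * Num.sqrt (z * s) / z.
have sqrt0 : 0 < Num.sqrt (z * s) by rewrite sqrtr_gt0 mulr_gt0.
have b0 : 0 < b by rewrite divr_gt0 ?mulr_gt0.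
have zbb : z * b ^+ 2 = s * L ^+ 2.
  have -> : z * b ^+ 2 = L ^+ 2 * Num.sqrt (z * s) ^+ 2 / z.
    by rewrite /b; field; rewrite gt_eqF.
  by rewrite sqr_sqrtr ?mulr_ge0 ?ltW//; field; rewrite gt_eqF.
have boundE t : 0 < t -> (z + s * L ^+ 2 / t ^+ 2) * (t * log / eps) =
    z * (t + b ^+ 2 / t) / a.
  by move=> t0; rewrite -zbb /a; field; rewrite !gt_eqF.
have [ab|/ltW ba] := leP a b.
(* The two terms balance at [b], which yields twice the square-root term. *)
- exists b; split; first split=> // t t_ge.
    have t0 : 0 < t by apply: lt_le_trans t_ge.
    rewrite !boundE//; apply: ler_wpM2r; first by rewrite invr_ge0 ltW.
    apply: ler_wpM2l; first exact: ltW.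
    rewrite -subr_ge0.
    have -> : t + b ^+ 2 / t - (b + b ^+ 2 / b) = (t - b) ^+ 2 / t.
      by field; rewrite !gt_eqF.
    by rewrite divr_ge0 ?sqr_ge0 ?ltW.
  rewrite boundE//.
  have -> : z * (b + b ^+ 2 / b) / a = 2 * (Num.sqrt (z * s) * L * log / eps).
    by rewrite /a /b; field; rewrite !gt_eqF.
  by rewrite ler_wpM2l// lerDr ltW.
(* Beyond [b] the function increases, so the endpoint [a] is optimal; as [b <= a], the value is at
   most [2 * z]. *)
- exists a; split; first split=> // t t_ge.
    have t0 : 0 < t by apply: lt_le_trans t_ge.
    rewrite !boundE//; apply: ler_wpM2r; first by rewrite invr_ge0 ltW.
    apply: ler_wpM2l; first exact: ltW.
    rewrite -subr_ge0.
    have -> : t + b ^+ 2 / t - (a + b ^+ 2 / a) = (t - a) * (a * t - b ^+ 2) / (a * t).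
      by field; rewrite !gt_eqF.
    apply: divr_ge0; last exact/ltW/mulr_gt0.
    apply: mulr_ge0; rewrite subr_ge0// expr2.
    by apply: ler_pM => //; [exact: ltW | exact: ltW | exact: le_trans ba t_ge].
  rewrite boundE//.
  have -> : z * (a + b ^+ 2 / a) / a = z + z * (b ^+ 2 / a ^+ 2).
    by field; rewrite !gt_eqF.
  have : b ^+ 2 / a ^+ 2 <= 1.
    by rewrite ler_pdivrMr ?exprn_gt0// mul1r; apply: lerXn2r => //; rewrite nnegrE ltW.
  move=> /(ler_wpM2l (ltW z0)); rewrite mulr1 => zb_le.
  have : 0 <= Num.sqrt (z * s) * L * log / eps.
    by apply: divr_ge0; rewrite ?mulr_ge0// ltW.
  lra.
Qed.

Theorem theorem1 (R : realType) :
  (forall (m n : nat) (A : 'M[R]_(m, n)) (eps alpha : R),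
     (0 < m)%N -> (0 < n)%N -> (m + n <= nnz A)%N ->
     0 < eps -> eps / log_size m n <= alpha ->
     [/\ (forall u, tapes u ->
            let z := result u (algorithm A eps alpha) in
            simplex z.1 /\ simplex z.2),
         expectation_of (algorithm A eps alpha) (duality_gap A) =
           expectation_of (algorithm A eps alpha) (coordinate_gap A)
       & expectation_of (algorithm A eps alpha) (duality_gap A) <= eps]) /\
  (exists C : R,
     forall (m n : nat) (A : 'M[R]_(m, n)) (eps alpha : R),
       (0 < m)%N -> (0 < n)%N -> (m + n <= nnz A)%N ->
       0 < eps -> eps / log_size m n <= alpha ->
       forall u, tapes u ->
         (time u (algorithm A eps alpha))%:R <= C * time_bound A eps alpha) /\
  (exists C : R,
     forall (m n : nat) (A : 'M[R]_(m, n)) (eps : R),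
       (0 < m)%N -> (0 < n)%N -> (m + n <= nnz A)%N -> 0 < eps ->
       (exists alpha, optimal_parameter A eps alpha) /\
       forall alpha, optimal_parameter A eps alpha ->
         forall u, tapes u ->
           (time u (algorithm A eps alpha))%:R <= C * optimal_time_bound A eps).
Proof.
split.
  move=> m n A eps alpha m0 n0 nnz_ge eps0 alpha_ge.
  have log0 := log_size_gt0 m0 n0 nnz_ge.
  have gapE : duality_gap A = coordinate_gap A by apply/funext => z; exact: duality_gapE.
  rewrite gapE; split=> //.
    move=> u u_tape.
    by have [zx_d [zy_d _]] := time_algorithm_le m0 n0 nnz_ge eps0 alpha_ge u_tape.
  apply: expectation_algorithm_le => //; first by apply: mx_norm_gt0; lia.
  by apply: lt_le_trans alpha_ge; rewrite divr_gt0.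
split.
  exists 2500 => m n A eps alpha m0 n0 nnz_ge eps0 alpha_ge u u_tape.
  by have [_ [_ time_le]] := time_algorithm_le m0 n0 nnz_ge eps0 alpha_ge u_tape.
exists 5000 => m n A eps m0 n0 nnz_ge eps0.
have [alpha' [alpha'_opt alpha'_le]] := time_bound_optimal_le m0 n0 nnz_ge eps0.
split; first by exists alpha'.
move=> alpha [alpha_ge alpha_min] u u_tape.
have [_ [_ /le_trans]] := time_algorithm_le m0 n0 nnz_ge eps0 alpha_ge u_tape; apply.
(* Minimality against the exhibited [alpha'] transfers its bound to every optimal parameter, and
   [5000 = 2500 * 2]. *)
have := alpha_min _ alpha'_opt.1; lra.
Qed.
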